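(* Let $N$ be a positive integer. Then there are suitable choices of power series $\gamma_N^{a,b}=\gamma_N^{a,b}(q)$ and $\lambda_N^{a,b}=\lambda_N^{a,b}(q)=\lambda_N^{b,a}(q)$ ($a,b\in\mathbb{Z}/N\mathbb{Z}$) which provide a solution to the linear system $$\gamma_N^{a,a}-\lambda_N^{a,a}=\tilde g^{a}_2(q)\quad\forall a\in\mathbb{Z}/N\mathbb{Z},\qquad \gamma_N^{a,b}+\gamma_N^{b,a}-2\lambda_N^{a,b}=0\quad\forall a\ne b\in\mathbb{Z}/N\mathbb{Z},$$ together with $$\gamma_N^{a+b,a}+\gamma_N^{a+b,b}-2\lambda_N^{a,b}=f^{a}_{2}(q)+f^{b}_{2}(q)\quad\forall a,b\in\mathbb{Z}/N\mathbb{Z}.$$ Consequently (with such choices of $\gamma_N^{a,b}$ and $\lambda_N^{a,b}$), for all $r,s\ge1$ and $a,b\in\mathbb{Z}/N\mathbb{Z}$ the power series $E_{r,s}^{a,b}(q)$, $P_{r,s}^{a,b}(q)$ and $E_k^a(q)$ satisfy the double shuffle relation at level $N$: $$P_{r,s}^{a,b}(q)=E_{r,s}^{a,b}(q)+E_{s,r}^{b,a}(q)+\delta_{a,b}E^{a}_{r+s}(q)=\sum_{\substack{i+j=r+s\\ i,j\ge1}}\left(\binom{i-1}{r-1}E_{i,j}^{a+b,b}(q)+\binom{i-1}{s-1}E_{i,j}^{a+b,a}(q)\right).$$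
   Context: Fix $N\ge1$, $\eta=e^{2\pi i/N}$; superscripts $a,b$ are residue classes modulo $N$; $\delta_{x,y}$ is the Kronecker symbol; $\binom00=1$. All series are power series in $q$ with complex coefficients. For $r,s\ge1$: $$\tilde g^a_s(q)=\frac{(-1)^s}{N^s(s-1)!}\sum_{u,v\ge1}\eta^{av}v^{s-1}q^{uv},$$ $$\tilde g^{a,b}_{r,s}(q)=\frac{(-1)^{r+s}}{N^{r+s}(r-1)!(s-1)!}\sum_{\substack{u_1>u_2>0\\ v_1,v_2\ge1}}\eta^{av_1+bv_2}v_1^{r-1}v_2^{s-1}q^{u_1v_1+u_2v_2}.$$ For $k\ge0$: $(\tilde g^a_k)'(q)=\frac{(-1)^k}{N^{k+1}k!}\sum_{n,v\ge1}n\,v^k\eta^{av}q^{nv}$ (for $k\ge 1$ this equals $\frac{q}{Nk}\frac{d}{dq}\tilde g^a_k(q)$). Also $f_2^a(q)=\frac1{N^2}\sum_{n,u\ge1}\eta^{au}n\,q^{nu}$. For $n\ge1$, with $B_n(x)$ the Bernoulli polynomials ($\frac{te^{xt}}{e^t-1}=\sum_{n\ge0}B_n(x)\frac{t^n}{n!}$): $$\beta^a_n=-\frac1{2N\cdot n!}\sum_{l=1}^N\exp\Big(-\frac{2\pi i\,la}{N}\Big)B_n\Big(\frac lN\Big).$$ For $r,s\ge1$: $$\beta_{r,s}^{a,b}(q)=\tilde g^a_r(q)\beta^b_s+\sum_{i+j=r+s,\ i,j\ge1}\beta^{a-b}_i\left[(-1)^s\binom{i-1}{s-1}\tilde g^a_j(q)+(-1)^{i-r}\binom{i-1}{r-1}\tilde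 g^b_j(q)\right],$$ $$\varepsilon_{r,s}^{a,b}(q)=\delta_{r,2}(\tilde g^b_s)'(q)-\delta_{r,1}(\tilde g^b_{s-1})'(q)+\delta_{s,1}\big((\tilde g^a_{r-1})'(q)+\tilde g^a_r(q)\big)+N\delta_{r,1}\delta_{s,1}\gamma_N^{a,b}(q).$$ Finally define $E^a_k(q)=\tilde g^a_k(q)$ if $k>2$ and $E^a_k(q)=0$ if $k\le2$; and for $r,s\ge1$ $$E_{r,s}^{a,b}(q)=\tilde g_{r,s}^{a,b}(q)+\beta_{r,s}^{a,b}(q)+\frac{\varepsilon_{r,s}^{a,b}(q)}{2N},$$ $$P_{r,s}^{a,b}(q)=\tilde g^a_r(q)\tilde g^b_s(q)+\beta^a_r\tilde g^b_s(q)+\beta^b_s\tilde g^a_r(q)+\frac{\delta_{r,2}(\tilde g^b_s)'(q)+\delta_{s,2}(\tilde g^a_r)'(q)}{2N}+\delta_{r,1}\delta_{s,1}\lambda_N^{a,b}(q).$$ Here $\gamma_N^{a,b}$ and $\lambda_N^{a,b}$ are the power series chosen in the claim. *)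

(* Defs.v *)
From HB Require Import structures.
From mathcomp Require Import all_boot all_order all_algebra.
From mathcomp Require Import all_classical all_reals all_analysis.
From mathcomp Require Import complex.

Set Implicit Arguments.
Unset Strict Implicit.
Unset Printing Implicit Defensive.

Import Order.TTheory GRing.Theory Num.Theory.

Local Open Scope ring_scope.
Local Open Scope complex_scope.

(** * Formal power series *)

(* A record rather than the bare type [nat -> R], on which [*] would denote the
   pointwise product. *)
Record fps (R : Type) := FPS { fcoef :> nat -> R }.

Notation "\fps_ i E" := (FPS (fun i : nat => E))
  (at level 34, E at level 36, i name, format "\fps_ i  E") : ring_scope.

Lemma fpsP (R : Type) (f g : fps R) : f =1 g <-> f = g.
Proof.
by split=> [|->//]; case: f; case: g => g f fg; congr FPS; apply/funext.
Qed.

HB.instance Definition _ (R : Type) := gen_eqMixin (fps R).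
HB.instance Definition _ (R : Type) := gen_choiceMixin (fps R).

Section FpsRing.
Variable R : comNzRingType.
Implicit Types f g h : fps R.

Definition fps_zero : fps R := \fps_i 0.
Definition fps_opp f : fps R := \fps_i (- f i).
Definition fps_add f g : fps R := \fps_i (f i + g i).
Definition fps_scale (c : R) f : fps R := \fps_i (c * f i).
Definition fps_one : fps R := \fps_i (i == 0%N)%:R.
Definition fps_mul f g : fps R := \fps_n \sum_(j < n.+1) f j * g (n - j)%N.

Fact fps_addA : associative fps_add.
Proof. by move=> f g h; apply/fpsP => i /=; rewrite addrA. Qed.
Fact fps_addC : commutative fps_add.
Proof. by move=> f g; apply/fpsP => i /=; rewrite addrC. Qed.
Fact fps_add0 : left_id fps_zero fps_add.
Proof. by move=> f; apply/fpsP => i /=; rewrite add0r. Qed.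
Fact fps_addN : left_inverse fps_zero fps_opp fps_add.
Proof. by move=> f; apply/fpsP => i /=; rewrite addNr. Qed.

HB.instance Definition _ :=
  GRing.isZmodule.Build (fps R) fps_addA fps_addC fps_add0 fps_addN.

Let trunc m f : {poly R} := \poly_(i < m.+1) f i.

Let coef_trunc m f i : (i <= m)%N -> (trunc m f)`_i = f i.
Proof. by move=> im; rewrite coef_poly ltnS im. Qed.

Let coef_truncM m f g i : (i <= m)%N ->
  (trunc m f * trunc m g)`_i = fps_mul f g i.
Proof.
move=> im; rewrite coefM; apply: eq_bigr => j _.
rewrite !coef_trunc ?(leq_trans (leq_subr _ _)) //.
by rewrite (leq_trans _ im) // -ltnS.
Qed.

Fact fps_mulA : associative fps_mul.
Proof.
move=> f g h; apply/fpsP => n.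
transitivity (trunc n f * (trunc n g * trunc n h))`_n.
  rewrite coefM; apply: eq_bigr => j _.
  by rewrite coef_truncM ?leq_subr // coef_trunc // -ltnS.
rewrite mulrA coefM; apply: eq_bigr => j _.
by rewrite coef_truncM ?coef_trunc ?leq_subr // -ltnS.
Qed.

Fact fps_mulC : commutative fps_mul.
Proof.
by move=> f g; apply/fpsP => n; rewrite -!(coef_truncM _ _ (leqnn n)) mulrC.
Qed.

Fact fps_mul1 : left_id fps_one fps_mul.
Proof.
move=> f; apply/fpsP => n /=; rewrite big_ord_recl /= mul1r subn0.
by rewrite big1 ?addr0 // => i _; rewrite mul0r.
Qed.

Fact fps_mulDl : left_distributive fps_mul +%R.
Proof.
move=> f g h; apply/fpsP => n /=; rewrite -big_split /=.
by apply: eq_bigr => i _; rewrite mulrDl.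
Qed.

Fact fps_one_neq0 : fps_one != 0.
Proof.
apply/eqP => /(congr1 (fun f : fps R => f 0%N)) /= /eqP.
by rewrite oner_eq0.
Qed.

HB.instance Definition _ := GRing.Zmodule_isComNzRing.Build (fps R)
  fps_mulA fps_mulC fps_mul1 fps_mulDl fps_one_neq0.

Fact fps_scaleA a b f : fps_scale a (fps_scale b f) = fps_scale (a * b) f.
Proof. by apply/fpsP => i /=; rewrite mulrA. Qed.
Fact fps_scale1 : left_id 1 fps_scale.
Proof. by move=> f; apply/fpsP => i /=; rewrite mul1r. Qed.
Fact fps_scaleDr : right_distributive fps_scale +%R.
Proof. by move=> a f g; apply/fpsP => i /=; rewrite mulrDr. Qed.
Fact fps_scaleDl f : {morph fps_scale^~ f : a b / a + b}.
Proof. by move=> a b; apply/fpsP => i /=; rewrite mulrDl. Qed.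

HB.instance Definition _ := GRing.Zmodule_isLmodule.Build R (fps R)
  fps_scaleA fps_scale1 fps_scaleDr fps_scaleDl.

Fact fps_scaleAl (a : R) f g : a *: (f * g) = (a *: f) * g.
Proof.
apply/fpsP => n /=; rewrite big_distrr /=.
by apply: eq_bigr => i _; rewrite mulrA.
Qed.

HB.instance Definition _ := GRing.Lmodule_isLalgebra.Build R (fps R) fps_scaleAl.
HB.instance Definition _ := GRing.Lalgebra_isComAlgebra.Build R (fps R).

Lemma fcoef0 i : (0 : fps R) i = 0. Proof. by []. Qed.
Lemma fcoef1 i : (1 : fps R) i = (i == 0%N)%:R. Proof. by []. Qed.
Lemma fcoefN f i : (- f) i = - f i. Proof. by []. Qed.
Lemma fcoefD f g i : (f + g) i = f i + g i. Proof. by []. Qed.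
Lemma fcoefB f g i : (f - g) i = f i - g i. Proof. by []. Qed.
Lemma fcoefZ c f i : (c *: f) i = c * f i. Proof. by []. Qed.
Lemma fcoefM f g n : (f * g) n = \sum_(j < n.+1) f j * g (n - j)%N.
Proof. by []. Qed.
Lemma fcoef_sum I (r : seq I) (P : pred I) (F : I -> fps R) i :
  (\sum_(k <- r | P k) F k) i = \sum_(k <- r | P k) F k i.
Proof. by elim/big_rec2: _ => // k y x _ <-. Qed.

End FpsRing.

Section FpsUnit.
Variable R : comUnitRingType.
Implicit Types f g : fps R.

(* The first [n] coefficients of the inverse of [f]. *)
Fixpoint fps_inv_seq f n : seq R :=
  if n isn't n'.+1 then [::] else
  let s := fps_inv_seq f n' in
  rcons s ((f 0%N)^-1 * ((n' == 0%N)%:R - \sum_(j < n') s`_j * f (n' - j)%N)).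

Definition fps_unit : {pred fps R} := fun f => f 0%N \is a GRing.unit.
Definition fps_inv f : fps R :=
  if f \in fps_unit then \fps_n (fps_inv_seq f n.+1)`_n else f.

Let size_inv_seq f n : size (fps_inv_seq f n) = n.
Proof. by elim: n => //= n IHn; rewrite size_rcons IHn. Qed.

Let nth_inv_seq f n i : (i < n)%N ->
  (fps_inv_seq f n)`_i = (fps_inv_seq f i.+1)`_i.
Proof.
elim: n => // n IHn; rewrite ltnS leq_eqVlt => /predU1P[->//|lt_in].
by rewrite [LHS]/= nth_rcons size_inv_seq lt_in IHn.
Qed.

Fact fps_mulVf : {in fps_unit, left_inverse 1 fps_inv *%R}.
Proof.
move=> f uf; apply/fpsP => n; rewrite fcoefM fcoef1 big_ord_recr /= subnn.
rewrite /fps_inv uf [X in _ + X * _]/= nth_rcons size_inv_seq ltnn eqxx.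
rewrite mulrAC mulVr // mul1r addrC -[RHS]subr0 -addrA; congr (_ + _).
apply/eqP; rewrite oppr0 addrC subr_eq0; apply/eqP; apply: eq_bigr => j _.
by rewrite [in RHS]nth_inv_seq.
Qed.

Fact fps_unitPl f g : g * f = 1 -> f \in fps_unit.
Proof.
move=> /(congr1 (fun h : fps R => h 0%N)).
rewrite fcoefM big_ord1 subnn fcoef1 => gf1.
by apply/unitrP; exists (g 0%N); rewrite [f _ * _]mulrC.
Qed.

Fact fps_inv_out : {in [predC fps_unit], fps_inv =1 id}.
Proof. by move=> f /negPf; rewrite /fps_inv => ->. Qed.

HB.instance Definition _ := GRing.ComNzRing_hasMulInverse.Build (fps R)
  fps_mulVf fps_unitPl fps_inv_out.

Lemma fps_unitE f : (f \is a GRing.unit) = (f 0%N \is a GRing.unit).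
Proof. by []. Qed.

End FpsUnit.

(** * Bernoulli polynomials *)

Section Bernoulli.
Variable F : numFieldType.

Definition fps_exp (x : F) : fps F := \fps_n (x ^+ n / n`!%:R).

Definition fps_X : fps F := \fps_n (n == 1%N)%:R.

(* [(f - f(0)) / t] *)
Definition fps_shift (f : fps F) : fps F := \fps_n f n.+1.

(* The value at [x] of the [n]-th Bernoulli polynomial.  As [exp t - 1] is not
   invertible as a power series, [t exp(x t) / (exp t - 1)] is written as
   [exp(x t) / ((exp t - 1) / t)]; see [bernoulliP]. *)
Definition bernoulli (n : nat) (x : F) : F :=
  n`!%:R * (fps_exp x / fps_shift (fps_exp 1)) n.

Lemma bernoulliP (x : F) :
  (fps_exp 1 - 1) * (\fps_n (bernoulli n x / n`!%:R)) = fps_X * fps_exp x.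
Proof.
have fac_neq0 n : (n`!%:R : F) != 0 by rewrite pnatr_eq0 -lt0n fact_gt0.
have -> : \fps_n (bernoulli n x / n`!%:R) = fps_exp x / fps_shift (fps_exp 1).
  by apply/fpsP => n; rewrite [LHS]/= /bernoulli mulrAC divff // mul1r.
have -> : fps_exp 1 - 1 = fps_X * fps_shift (fps_exp 1).
  apply/fpsP => -[|n]; rewrite fcoefM.
    by rewrite big_ord1 /= mul0r fact0 expr0 divr1 subrr.
  rewrite 2!big_ord_recl big1 /= ?mul0r ?mul1r ?add0r ?addr0 => [|i _].
    by rewrite subr0 subn1.
  by rewrite mul0r.
rewrite mulrACA divrr ?mulr1 //.
by rewrite fps_unitE unitfE /= expr1n mul1r invr_eq0.
Qed.

End Bernoulli.

(** * Level [N] double Eisenstein series *)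

(* Residue classes modulo [N], for [N > 0]; unlike ['Z_N], this is also correct
   for [N = 1]. *)
Notation Zmod N := 'I_N.-1.+1.

Section DoubleShuffle.
Variables (R : realType) (N : nat).
Local Notation C := R[i].
Local Notation series := (fps C).
Implicit Types (a b : Zmod N) (r s k n : nat).

(* [exp(i t)] *)
Definition expi (t : R) : C := cos t +i* sin t.

Definition eta : C := expi (2 * pi / N%:R).

(* [\sum_(u, v >= 1) c u v q^(u v)] *)
Definition qsum2 (c : nat -> nat -> C) : series :=
  \fps_n \sum_(1 <= u < n.+1) \sum_(1 <= v < n.+1 | (u * v == n)%N) c u v.

(* [\sum_(u1 > u2 > 0; v1, v2 >= 1) c v1 v2 q^(u1 v1 + u2 v2)] *)
Definition qsum4 (c : nat -> nat -> C) : series :=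
  \fps_n \sum_(1 <= u1 < n.+1) \sum_(1 <= u2 < u1)
    \sum_(1 <= v1 < n.+1) \sum_(1 <= v2 < n.+1 | (u1 * v1 + u2 * v2 == n)%N)
      c v1 v2.

Definition gtilde a s : series :=
  ((-1) ^+ s / (N%:R ^+ s * (s.-1)`!%:R)) *:
    qsum2 (fun _ v => eta ^+ (a * v) * v%:R ^+ s.-1).

Definition gtilde2 a b r s : series :=
  ((-1) ^+ (r + s) / (N%:R ^+ (r + s) * (r.-1)`!%:R * (s.-1)`!%:R)) *:
    qsum4 (fun v1 v2 =>
      eta ^+ (a * v1 + b * v2) * v1%:R ^+ r.-1 * v2%:R ^+ s.-1).

(* [dgtilde a k] is the series written [(g~^a_k)'], also for [k = 0]. *)
Definition dgtilde a k : series :=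
  ((-1) ^+ k / (N%:R ^+ k.+1 * k`!%:R)) *:
    qsum2 (fun n v => n%:R * v%:R ^+ k * eta ^+ (a * v)).

Definition f2 a : series :=
  (N%:R ^+ 2)^-1 *: qsum2 (fun n u => eta ^+ (a * u) * n%:R).

Definition beta a n : C :=
  - (2 * N%:R * n`!%:R)^-1 *
    \sum_(1 <= l < N.+1)
      expi (- (2 * pi * l%:R * a%:R / N%:R)) * bernoulli n (l%:R / N%:R).

Definition beta2 a b r s : series :=
  beta b s *: gtilde a r +
  \sum_(1 <= i < r + s)
    beta (a - b) i *:
      (((-1) ^+ s * 'C(i.-1, s.-1)%:R) *: gtilde a (r + s - i)%N
       + ((-1) ^ (i%:Z - r%:Z) * 'C(i.-1, r.-1)%:R) *: gtilde b (r + s - i)%N).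

Definition E1 a k : series := if (2 < k)%N then gtilde a k else 0.

Definition suitable (gam lam : Zmod N -> Zmod N -> series) : Prop :=
  [/\ forall a b, lam a b = lam b a,
      forall a, gam a a - lam a a = gtilde a 2,
      forall a b, a != b -> gam a b + gam b a - 2 *: lam a b = 0
    & forall a b,
        gam (a + b) a + gam (a + b) b - 2 *: lam a b = f2 a + f2 b].

Variables gam lam : Zmod N -> Zmod N -> series.

Definition epsilon a b r s : series :=
  (r == 2%N)%:R *: dgtilde b s - (r == 1%N)%:R *: dgtilde b s.-1
  + (s == 1%N)%:R *: (dgtilde a r.-1 + gtilde a r)
  + (N%:R * (r == 1%N)%:R * (s == 1%N)%:R) *: gam a b.

Definition E2 a b r s : series :=
  gtilde2 a b r s + beta2 a b r s + (2 * N%:R)^-1 *: epsilon a b r s.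

Definition P2 a b r s : series :=
  gtilde a r * gtilde b s + beta a r *: gtilde b s + beta b s *: gtilde a r
  + (2 * N%:R)^-1 *: ((r == 2%N)%:R *: dgtilde b s + (s == 2%N)%:R *: dgtilde a r)
  + ((r == 1%N)%:R * (s == 1%N)%:R) *: lam a b.

End DoubleShuffle.

(* Main.v *)
Require Import Defs.
From mathcomp Require Import all_boot all_order all_algebra.
From mathcomp Require Import all_classical all_reals all_analysis.
From mathcomp Require Import complex zify ring.

Set Implicit Arguments.
Unset Strict Implicit.
Unset Printing Implicit Defensive.

Import Order.TTheory GRing.Theory Num.Theory.

Local Open Scope ring_scope.

(** In a fixed weight [r + s = m + 2], collect a family [c_{r,s}] into the
homogeneous polynomial [sum x^(r-1) y^(s-1) c_{r,s}].  The binomial sums of the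
shuffle side then become the substitutions [(x + y, y)] and [(x + y, x)].

Splitting the product of two single sums according to [u1 > u2], [u1 < u2],
[u1 = u2] gives the stuffle relation, and according to [v1 < v2], [v1 > v2],
[v1 = v2] the shuffle relation.  In the shuffle case the diagonal is a derivative
and the [beta] terms cancel formally.  In the stuffle case the diagonal at [q^w]
is a geometric sum in [xi = eta^a exp(- x t / N)] and
[upsilon = eta^b exp(- y t / N)]; it is evaluated by
[xi^w - upsilon^w = (xi - upsilon) (...)] and by the fact that
[sum_n beta^c_n t^n] is [t / (2 N)] divided by [eta^c exp(- t / N) - 1].

The linear system for [gam] and [lam] amounts to
[gam (a + b) a + gam (a + b) b - gam a b - gam b a = h a b] with [h] symmetric.
By the Euclidean algorithm its only obstructions are the sums of [h] over the
pairs with [gcd(a, b, N)] fixed, and these vanish by the distribution relation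
between [f2] and [gtilde _ 2]. *)

(** * Dilations and exponentials of formal power series *)

Section PowerSeries.
Variable F : numFieldType.
Implicit Types (f g h : fps F) (x y z : F) (m n : nat).

(** The substitution of [z t] for [t]; it carries [beta_gf] from [t] to [(x - y) t]. *)
Definition fps_dil z f : fps F := \fps_n (f n * z ^+ n).

Lemma fps_dilM z f g : fps_dil z (f * g) = fps_dil z f * fps_dil z g.
Proof.
apply/fpsP => n; rewrite [LHS]/= !fcoefM mulr_suml; apply: eq_bigr => j _ /=.
by rewrite mulrACA -exprD subnKC // -ltnS.
Qed.

Lemma fps_dilB z f g : fps_dil z (f - g) = fps_dil z f - fps_dil z g.
Proof. by apply/fpsP => n; exact: mulrBl. Qed.

Lemma fps_dilZ z c f : fps_dil z (c *: f) = c *: fps_dil z f.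
Proof. by apply/fpsP => n; rewrite [RHS]/= mulrA. Qed.

Lemma fps_dil1 z : fps_dil z 1 = 1.
Proof.
by apply/fpsP => -[|n]; rewrite [LHS]/= fcoef1 ?mul1r ?mul0r.
Qed.

Lemma fps_dilX z : fps_dil z (fps_X F) = z *: fps_X F.
Proof.
by apply/fpsP => -[|[|n]]; rewrite [LHS]/= fcoefZ /= ?mul0r ?mulr0 // mul1r mulr1.
Qed.

Lemma fps_dil_exp z x : fps_dil z (fps_exp x) = fps_exp (z * x).
Proof. by apply/fpsP => n /=; rewrite exprMn; ring. Qed.

Lemma natr_fact_neq0 n : (n`!%:R : F) != 0.
Proof. by rewrite pnatr_eq0 -lt0n fact_gt0. Qed.

Lemma divr_fact i j : (i`!%:R * j`!%:R : F)^-1 = 'C(i + j, i)%:R / (i + j)`!%:R.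
Proof.
have -> : 'C(i + j, i)%:R = (i + j)`!%:R / (i`!%:R * j`!%:R) :> F.
  rewrite -(@bin_fact (i + j) i) ?leq_addr // addKn !natrM.
  by rewrite mulfK // mulf_neq0 ?natr_fact_neq0.
by rewrite mulrAC divff ?natr_fact_neq0 // mul1r.
Qed.

Lemma fps_expD x y : fps_exp x * fps_exp y = fps_exp (x + y).
Proof.
apply/fpsP => n; rewrite fcoefM /= addrC exprDn mulr_suml.
apply: eq_bigr => -[i /= le_in] _; rewrite ltnS in le_in.
rewrite -[in RHS]mulr_natl mulrACA -invfM divr_fact subnKC //; ring.
Qed.

Lemma fps_exp0 : fps_exp 0 = 1 :> fps F.
Proof.
by apply/fpsP => -[|n]; rewrite fcoef1 /= ?divr1 // expr0n /= mul0r.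
Qed.

Lemma fps_expX x n : fps_exp x ^+ n = fps_exp (n%:R * x).
Proof.
elim: n => [|n IHn]; first by rewrite mul0r fps_exp0.
by rewrite exprS IHn fps_expD; congr fps_exp; rewrite -natr1; ring.
Qed.

Lemma fps_coefXM f n : (fps_X F * f) n = if n is m.+1 then f m else 0.
Proof.
case: n => [|n]; rewrite fcoefM; first by rewrite big_ord1 mul0r.
rewrite 2!big_ord_recl big1 /= ?mul0r ?mul1r ?add0r ?addr0 ?subn1 // => i _.
by rewrite mul0r.
Qed.

Lemma fps_XI f g : fps_X F * f = fps_X F * g -> f = g.
Proof.
by move=> eq_fg; apply/fpsP => n; have /fpsP/(_ n.+1) := eq_fg; rewrite !fps_coefXM.
Qed.

(** The series [exp t - 1] is [t] times a unit, and both factors can be cancelled. *)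
Lemma fps_exp_subr1I f g : (fps_exp 1 - 1) * f = (fps_exp 1 - 1) * g -> f = g.
Proof.
have -> : fps_exp 1 - 1 = fps_X F * fps_shift (fps_exp 1).
  apply/fpsP => n; rewrite fps_coefXM; case: n => [|n].
    by rewrite fcoefB fcoef1 /= expr0 divr1 subrr.
  by rewrite fcoefB fcoef1 /= subr0.
rewrite -!mulrA => /fps_XI; apply: mulrI.
by rewrite fps_unitE unitfE /= expr1n mul1r invr_eq0 oner_eq0.
Qed.

End PowerSeries.

(** * Homogeneous generating functions and binomial substitutions *)

(* The generating function in weight [m + 2] of a family indexed by [r, s >= 1],
   with [c i j] the member at [r = i + 1], [s = j + 1]. *)
Section WeightGeneratingFunction.
Variable F : numFieldType.
Implicit Types (c : nat -> nat -> F) (x y e f : F) (m i j r s : nat).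

Definition wgf m c x y : F := \sum_(i < m.+1) x ^+ i * y ^+ (m - i) * c i (m - i)%N.

Lemma eq_wgf m c1 c2 x y : (forall i j, (i + j)%N = m -> c1 i j = c2 i j) ->
  wgf m c1 x y = wgf m c2 x y.
Proof.
by move=> eq_c; apply: eq_bigr => i _; rewrite eq_c // subnKC // -ltnS.
Qed.

Lemma wgfC m c x y : wgf m (fun i j => c j i) x y = wgf m c y x.
Proof.
rewrite /wgf (reindex_inj rev_ord_inj); apply: eq_bigr => -[i /= le_im] _.
by rewrite subSS subKn //; ring.
Qed.

Lemma wgfD m c1 c2 x y :
  wgf m (fun i j => c1 i j + c2 i j) x y = wgf m c1 x y + wgf m c2 x y.
Proof. by rewrite /wgf -big_split; apply: eq_bigr => i _ /=; rewrite mulrDr. Qed.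

Lemma wgfN m c x y : wgf m (fun i j => - c i j) x y = - wgf m c x y.
Proof. by rewrite /wgf -sumrN; apply: eq_bigr => i _; rewrite mulrN. Qed.

Lemma wgfB m c1 c2 x y :
  wgf m (fun i j => c1 i j - c2 i j) x y = wgf m c1 x y - wgf m c2 x y.
Proof. by rewrite wgfD wgfN. Qed.

Lemma wgfZ m k c x y : wgf m (fun i j => k * c i j) x y = k * wgf m c x y.
Proof. by rewrite /wgf mulr_sumr; apply: eq_bigr => i _; rewrite mulrCA. Qed.

Lemma wgf_sum m (I : Type) (t : seq I) (P : pred I) (c : I -> nat -> nat -> F) x y :
  wgf m (fun i j => \sum_(k <- t | P k) c k i j) x y
  = \sum_(k <- t | P k) wgf m (c k) x y.
Proof.
by rewrite /wgf exchange_big; apply: eq_bigr => i _ /=; rewrite mulr_sumr.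
Qed.

(** Binomial expansion of [(e x + f y)^i], with the two sums exchanged. The shuffle sums use
    [e = f = 1]; the signed sums in [mix] use opposite signs. *)
Lemma wgf_subst m e f c x y :
  wgf m (fun r s => \sum_(i < (r + s).+1)
    'C(i, r)%:R * e ^+ r * f ^+ (i - r) * c i (r + s - i)%N) x y
  = wgf m c (e * x + f * y) y.
Proof.
transitivity (\sum_(r < m.+1) \sum_(i < m.+1)
   x ^+ r * y ^+ (m - r) * ('C(i, r)%:R * e ^+ r * f ^+ (i - r) * c i (m - i)%N)).
  apply: eq_bigr => -[r /= le_rm] _; rewrite ltnS in le_rm.
  by rewrite mulr_sumr subnKC.
rewrite exchange_big; apply: eq_bigr => -[i /= le_im] _; rewrite ltnS in le_im.
rewrite [e * x + _]addrC exprDn !mulr_suml.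
rewrite (big_ord_widen m.+1 (fun r => ((f * y) ^+ (i - r) * (e * x) ^+ r
  *+ 'C(i, r)) * y ^+ (m - i) * c i (m - i)%N)) //.
rewrite [RHS]big_mkcond; apply: eq_bigr => -[r /= _] _.
rewrite ltnS; case: leqP => [le_ri|lt_ir]; last by rewrite bin_small //; ring.
have -> : (m - r = (m - i) + (i - r))%N by rewrite addnBA // subnK.
by rewrite -mulr_natl !exprMn exprD; ring.
Qed.

(** At [y = 1] the difference is a polynomial in [x] of degree at most [m] that vanishes at
    [2, 3, 4, ...]. These points avoid [x = y], so a factor [x - y] may be cancelled before this is
    applied. *)
Lemma wgf_inj m c1 c2 : 
  (forall x y, x != y -> wgf m c1 x y = wgf m c2 x y) ->
  forall i j, (i + j)%N = m -> c1 i j = c2 i j.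
Proof.
move=> eq_c i j ijm; pose p := \poly_(i < m.+1) (c1 i (m - i)%N - c2 i (m - i)%N).
have rootp (k : nat) : root p k.+2%:R.
  rewrite /root horner_poly; apply/eqP.
  have k_neq1 : k.+2%:R != 1 :> F by rewrite -natr1 -subr_eq0 addrK pnatr_eq0.
  rewrite -[RHS](subrr (wgf m c2 k.+2%:R 1)) -[X in _ = X - _]eq_c // -wgfB.
  by apply: eq_bigr => l _; rewrite expr1n mulr1 mulrC.
have : p = 0.
  apply/eqP; apply: contraT => p_neq0.
  pose t : seq F := [seq k.+2%:R | k <- iota 0 m.+1].
  have /(max_poly_roots p_neq0) : all (root p) t.
    by apply/allP => _ /mapP[k _ ->].
  rewrite map_inj_uniq ?iota_uniq => [/(_ isT)|k l /eqP].
    by rewrite size_map size_iota ltnNge size_poly.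
  by rewrite eqr_nat !eqSS => /eqP.
move=> /(congr1 (fun q : {poly F} => q`_i)); rewrite coef0 coef_poly.
rewrite ltnS -ijm leq_addr addKn.
by move/eqP; rewrite subr_eq0 => /eqP.
Qed.

End WeightGeneratingFunction.

(** * Roots of unity *)

Lemma sum_unity_root (F : idomainType) (z : F) (n : nat) : z ^+ n = 1 ->
  \sum_(l < n) z ^+ l = n%:R * (z == 1)%:R.
Proof.
move=> zn; have [->|z_neq1] := eqVneq z 1.
  by under eq_bigr do rewrite expr1n; rewrite sumr_const card_ord mulr1.
apply/(mulfI (x := z - 1)); first by rewrite subr_eq0.
by rewrite -subrX1 zn subrr !mulr0.
Qed.

Section RootsOfUnity.
Variable R : realType.
Implicit Types (t : R) (N n k : nat).

Lemma expiD : {morph @expi R : s t / s + t >-> s * t}.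
Proof. by move=> s t; rewrite /expi cosD sinD; simpc; congr (_ +i* _)%C; ring. Qed.

Lemma expi0 : expi 0 = 1 :> R[i].
Proof. by rewrite /expi cos0 sin0. Qed.

Lemma expi_neq0 t : expi t != 0.
Proof.
apply: contra_neq (oner_neq0 R[i]) => t0.
by rewrite -expi0 -(subrr t) expiD t0 mul0r.
Qed.

Lemma expiN t : expi (- t) = (expi t)^-1.
Proof. by apply: (mulIf (expi_neq0 t)); rewrite -expiD addNr expi0 mulVf ?expi_neq0. Qed.

Lemma expiX t n : expi t ^+ n = expi (n%:R * t).
Proof.
elim: n => [|n IHn]; first by rewrite mul0r expi0.
by rewrite exprS IHn -expiD; congr expi; rewrite -natr1; ring.
Qed.

Lemma eta_neq0 N : eta R N != 0. Proof. exact: expi_neq0. Qed.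

Lemma etaX N n : eta R N ^+ n = expi (2 * pi * n%:R / N%:R).
Proof. by rewrite expiX; congr expi; ring. Qed.

Lemma expr_eta N : (0 < N)%N -> eta R N ^+ N = 1.
Proof.
move=> N_gt0; rewrite etaX mulfK ?pnatr_eq0 ?gtn_eqF //.
by rewrite /expi mulr_natl cos2pi sin2pi.
Qed.

(** If [eta^(k + 1) = 1] with [k + 1 < N], real parts give [cos t = 1] for some [0 < t < 2 pi]; the
    double-angle formula then forces [sin (t / 2) = 0], although [0 < t / 2 < pi]. *)
Lemma eta_prim N : (0 < N)%N -> N.-primitive_root (eta R N).
Proof.
move=> N_gt0; apply/andP; split=> //; apply/forallP => -[k /= lt_kN].
rewrite unity_rootE; have [eq_kN|neq_kN] := eqVneq k.+1 N.
  by rewrite eq_kN expr_eta // !eqxx.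
have {lt_kN neq_kN} lt_kN : (k.+1 < N)%N by rewrite ltn_neqAle neq_kN.
rewrite eqbF_neg; apply/eqP; rewrite etaX => /(congr1 (@complex.Re R)) /= /eqP.
set t : R := 2 * pi * k.+1%:R / N%:R.
have N0 : 0 < N%:R :> R by rewrite ltr0n.
have t_gt0 : 0 < t by rewrite divr_gt0 // mulr_gt0 // mulr_gt0 // pi_gt0.
have t_lt : t < 2 * pi by rewrite ltr_pdivrMr // ltr_pM2l ?ltr_nat // mulr_gt0 ?pi_gt0.
have -> : t = (t / 2) *+ 2 by rewrite -mulr_natr divfK // pnatr_eq0.
have /lt0r_neq0/eqP sin_neq0 : 0 < sin (t / 2).
  by apply: sin_gt0_pi; rewrite divr_gt0 //= ltr_pdivrMr // mulrC.
move=> /eqP cos1; apply/sin_neq0/eqP; rewrite -sqrf_eq0; apply/eqP.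
have := cos2Dsin2 (t / 2); move: cos1; rewrite cos_mulr2n => cos1 cs1.
have cs2 : cos (t / 2) ^+ 2 = 1.
  apply: (mulIf (x := 2)); rewrite ?pnatr_eq0 // mulr_natr.
  by apply: (addIr (-1)); rewrite cos1; ring.
by apply: (addrI (cos (t / 2) ^+ 2)); rewrite cs1 cs2 addr0.
Qed.

Lemma eta_eq1 N k : (0 < N)%N -> (eta R N ^+ k == 1) = (N %| k)%N.
Proof. by move=> /eta_prim/prim_order_dvd ->. Qed.

Lemma expr_eta_mod N n : (0 < N)%N -> eta R N ^+ (n %% N) = eta R N ^+ n.
Proof. by move=> /expr_eta /expr_mod ->. Qed.

(** The representative of [a + b] is reduced modulo [N.-1.+1], which is [N] for positive [N], and
    [eta^N = 1]. *)
Lemma eta_add N (a b : Zmod N) n : (0 < N)%N ->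
  eta R N ^+ ((a + b)%R * n) = eta R N ^+ (a * n) * eta R N ^+ (b * n).
Proof.
move=> N_gt0; rewrite !(exprM _ _ n) -exprMn -exprD; congr (_ ^+ _).
by rewrite -[in RHS]expr_eta_mod // -[X in _ = _ ^+ (_ %% X)](prednK N_gt0).
Qed.

End RootsOfUnity.

(** * The generating function of the constants [beta] *)

Section BetaGeneratingFunction.
Variables (R : realType) (N : nat).
Hypothesis N_gt0 : (0 < N)%N.
Local Notation C := R[i].
Local Notation ee := (eta R N).
Implicit Type a : Zmod N.

Let N_neq0 : (N%:R : C) != 0. Proof. by rewrite pnatr_eq0 -lt0n. Qed.

Lemma beta_eta a n : beta R a n =
  - (2 * N%:R)^-1 * \sum_(1 <= l < N.+1)
      (ee ^+ a)^-1 ^+ l * (bernoulli n (l%:R / N%:R) / n`!%:R).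
Proof.
rewrite /beta !mulr_sumr; apply: eq_big_nat => l _.
rewrite expiN exprVn -exprM etaX natrM.
have -> : 2 * pi * l%:R * a%:R / N%:R = 2 * pi * (a%:R * l%:R) / N%:R :> R by ring.
by rewrite invfM; ring.
Qed.

(** Since [B_0 = 1], this is a sum over all powers of a root of unity, which vanishes unless
    [a = 0]. *)
Lemma beta0 a : beta R a 0 = - (a == 0)%:R / 2.
Proof.
rewrite beta_eta.
have b0 x : @bernoulli C 0 x / 0`!%:R = 1.
  have sh_unit : fps_shift (fps_exp 1) \is a (@GRing.unit (fps C)).
    by rewrite fps_unitE unitfE /= expr1n mul1r invr_eq0 oner_eq0.
  have /fpsP/(_ 0%N) := divrK sh_unit (fps_exp x).
  rewrite fcoefM big_ord1 /= expr1n expr0 !divr1 mulr1 /bernoulli mul1r.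
  by [].
under eq_big_nat do rewrite b0 mulr1.
rewrite big_add1 big_mkord.
under eq_bigr do rewrite exprVn -exprM.
rewrite (reindex_inj rev_ord_inj) /=.
(* The reversal of the index turns inverse powers into powers, because [eta^N = 1]. *)
have -> : \sum_(l < N) ee ^- (a * (N - l.+1).+1) = \sum_(l < N) ee ^+ (a * l).
  apply: eq_bigr => -[l /= lt_lN] _; rewrite -subSn // subSS.
  apply: (mulIf (x := ee ^+ (a * (N - l)))); first by rewrite expf_neq0 ?eta_neq0.
  rewrite mulVf ?expf_neq0 ?eta_neq0 // -exprD -mulnDr subnKC 1?ltnW //.
  by rewrite mulnC exprM expr_eta // expr1n.
under eq_bigr do rewrite exprM.
rewrite sum_unity_root -?exprM 1?mulnC ?exprM ?expr_eta ?expr1n // eta_eq1 //.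
have -> : (N %| a)%N = (a == 0).
  rewrite -val_eqE /=; case: posnP => [->|a_gt0]; first by rewrite dvdn0.
  by rewrite gtnNdvd // -[X in (_ < X)%N](prednK N_gt0).
by field.
Qed.

(* The sum starts at [n = 0]: by [beta0] that term is the correction
   [delta_{a,b} E_{r+s}] of the stuffle relation. *)
Lemma beta_gf a :
  (ee ^+ a *: fps_exp (- N%:R^-1) - 1) * (\fps_n beta R a n)
  = (2 * N%:R)^-1 *: fps_X C.
Proof.
(* Here [w] is [eta^a exp(- t / N)] and [z] is its inverse, so that [z^N = exp t]. *)
pose w : fps C := ee ^+ a *: fps_exp (- N%:R^-1).
pose z : fps C := (ee ^+ a)^-1 *: fps_exp N%:R^-1.
have ea_neq0 : ee ^+ a != 0 by rewrite expf_neq0 ?eta_neq0.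
have wz : w * z = 1.
  by rewrite -scalerAl -scalerAr scalerA mulfV // scale1r fps_expD addNr fps_exp0.
have zX l : z ^+ l = (ee ^+ a)^-1 ^+ l *: fps_exp (l%:R / N%:R).
  by rewrite exprZn fps_expX.
have zN : z ^+ N = fps_exp 1.
  by rewrite zX exprVn -exprM mulnC exprM expr_eta // expr1n invr1 scale1r divff.
(* The factor [exp t - 1] turns the Bernoulli series at [l / N] into [t exp(l t / N)], so the sum
   over [l] becomes a geometric sum in [z]. *)
have beE : (fps_exp 1 - 1) * (\fps_n beta R a n)
    = - (2 * N%:R)^-1 *: (fps_X C * \sum_(l < N) z ^+ l.+1).
  have -> : (\fps_n beta R a n) = - (2 * N%:R)^-1 *: \sum_(l < N)
      (ee ^+ a)^-1 ^+ l.+1 *: \fps_n (bernoulli n (l.+1%:R / N%:R) / n`!%:R).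
    apply/fpsP => n; rewrite [LHS]/= fcoefZ fcoef_sum beta_eta.
    by rewrite big_add1 big_mkord.
  rewrite -scalerAr; congr (_ *: _); rewrite !mulr_sumr; apply: eq_bigr => l _.
  by rewrite -scalerAr bernoulliP zX scalerAr.
apply: fps_exp_subr1I; rewrite -/w mulrCA beE -scalerAr mulrCA -scalerAr.
(* The sum telescopes, since [(w - 1) z^(l + 1) = z^l - z^(l + 1)]. *)
have -> : (w - 1) * (\sum_(l < N) z ^+ l.+1) = 1 - fps_exp 1.
  rewrite -zN -[1 - z ^+ N]opprB subrX1 -mulNr !mulr_sumr; apply: eq_bigr => l _.
  by rewrite exprS mulrA mulrBl wz mul1r opprB.
by rewrite scaleNr -scalerN -mulrN opprB [fps_X C * _]mulrC.
Qed.

End BetaGeneratingFunction.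

(** * The stuffle diagonal as a geometric sum *)

Lemma fps_coef_key (F : numFieldType) m (k : F) (A B f g h : fps F) :
  (A + B) * (f - g) = k *: (fps_X F * (2 * h + (f + g))) ->
  (A * f) m.+1 - (A * g) m.+1 + ((B * f) m.+1 - (B * g) m.+1)
  = k * (2 * h m + (f m + g m)).
Proof.
move=> /(congr1 (fun f : fps F => f m.+1)).
rewrite fcoefZ fps_coefXM mulrDl !mulrBr !fcoefD !fcoefN => ->.
by rewrite !mulr_natl mulr2n fcoefD -mulr2n.
Qed.

Section Stuffle.
Variables (R : realType) (N : nat).
Hypothesis N_gt0 : (0 < N)%N.
Local Notation C := R[i].
Local Notation ee := (eta R N).
Implicit Types (a b : Zmod N) (x y : C) (m n i j r s v w : nat).

Let N_neq0 : (N%:R : C) != 0. Proof. by rewrite pnatr_eq0 -lt0n. Qed.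

(** The contribution of a pair [(u, v)] to the coefficient of [q^(u v)] in [gtilde a j.+1]; it does
    not depend on [u]. *)
Definition gcoef a j v : C :=
  (-1) ^+ j.+1 / (N%:R ^+ j.+1 * j`!%:R) * (ee ^+ (a * v) * v%:R ^+ j).

(* The sum in [beta2 a b r.+1 s.+1], with [G j] and [H j] standing for
   [gtilde a j.+1] and [gtilde b j.+1]. *)
Definition mix a b (G H : nat -> C) r s : C :=
  \sum_(i < (r + s).+1) beta R (a - b) i.+1 *
    ((-1) ^+ (i - r) * 'C(i, r)%:R * H (r + s - i)%N
     - (-1) ^+ s * 'C(i, s)%:R * G (r + s - i)%N).

(** The signed binomials are those of powers of [x - y], so both halves of [mix] are cases of
    [wgf_subst], the second with [x] and [y] exchanged. *)
Lemma wgf_mix m a b G H x y :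
  wgf m (mix a b G H) x y = wgf m (fun i j => beta R (a - b) i.+1 * H j) (x - y) y
    - wgf m (fun i j => beta R (a - b) i.+1 * G j) (x - y) x.
Proof.
have -> : x - y = 1 * x + (-1) * y by ring.
rewrite -wgf_subst [1 * x + _]addrC -wgf_subst.
rewrite -[in X in _ - X]wgfC -wgfB; apply: eq_wgf => r s _.
rewrite /mix [(s + r)%N]addnC -sumrB; apply: eq_bigr => i _.
by rewrite !expr1n; ring.
Qed.

(** The series [eta^a exp(- x t / N)] in [t]; [upsilon] in the introduction is [xi b y]. *)
Definition xi a x : fps C := ee ^+ a *: fps_exp (- (x / N%:R)).

Lemma xiX a x v : xi a x ^+ v = ee ^+ (a * v) *: fps_exp (v%:R * - (x / N%:R)).
Proof. by rewrite exprZn fps_expX exprM. Qed.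

Lemma gcoef_xi a x j v : x ^+ j * gcoef a j v = - N%:R^-1 * (xi a x ^+ v) j.
Proof.
rewrite xiX fcoefZ /= /gcoef mulrN -[- (v%:R * _)]mulN1r !exprMn exprVn !exprS.
by field; rewrite natr_fact_neq0 expf_neq0.
Qed.

(** The quotient of [xi a x] by [xi b y] is [eta^(a - b) exp(- (x - y) t / N)]; hence this is
    [beta_gf] for [a - b], dilated by [x - y] and multiplied by [xi b y]. *)
Lemma beta_xi a b x y :
  fps_dil (x - y) (\fps_n beta R (a - b) n) * (xi a x - xi b y)
  = ((x - y) / (2 * N%:R)) *: (fps_X C * xi b y).
Proof.
have /(congr1 (fps_dil (x - y))) := beta_gf R N_gt0 (a - b).
rewrite fps_dilM fps_dilB fps_dil1 !fps_dilZ fps_dilX fps_dil_exp scalerA.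
rewrite [_ / (2 * _)]mulrC scalerAl => <-; rewrite mulrAC mulrC; congr (_ * _).
rewrite mulrBl mul1r; congr (_ - _).
rewrite /xi -scalerAl -scalerAr scalerA fps_expD; congr (_ *: fps_exp _).
  have := eta_add R (a - b) b 1 N_gt0.
  by rewrite subrK !muln1.
by field.
Qed.

(** Multiplication by [p] raises every exponent of [p] by one and so completes the sum to a Cauchy
    coefficient at [m + 1], except for the term with [beta_0], which is subtracted. *)
Lemma wgf_beta_gcoef m a b p y w :
  p * wgf m (fun i j => beta R a i.+1 * gcoef b j w) p y
  = - N%:R^-1 * (fps_dil p (\fps_n beta R a n) * xi b y ^+ w) m.+1
    - beta R a 0 * (y ^+ m.+1 * gcoef b m.+1 w).
Proof.
have -> : - N%:R^-1 * (fps_dil p (\fps_n beta R a n) * xi b y ^+ w) m.+1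
    = \sum_(i < m.+2) beta R a i * p ^+ i *
        (y ^+ (m.+1 - i) * gcoef b (m.+1 - i) w).
  by rewrite fcoefM mulr_sumr; apply: eq_bigr => i _; rewrite gcoef_xi /=; ring.
rewrite big_ord_recl expr0 mulr1 subn0 [X in _ = X - _]addrC addrK mulr_sumr.
by apply: eq_bigr => i _; rewrite lift0 subSS exprS; ring.
Qed.

Lemma wgf_diag m a b x y w :
  wgf m (fun r s => (-1) ^+ (r + s) / (N%:R ^+ (r + s).+2 * r`!%:R * s`!%:R) *
     \sum_(1 <= v < w) ee ^+ (a * v + b * (w - v)) * v%:R ^+ r * (w - v)%:R ^+ s) x y
  = (N%:R ^+ 2)^-1 * \sum_(1 <= v < w) (xi a x ^+ v * xi b y ^+ (w - v)) m.
Proof.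
rewrite mulr_sumr.
under eq_wgf do rewrite mulr_sumr.
rewrite wgf_sum; apply: eq_bigr => v _.
rewrite fcoefM mulr_sumr; apply: eq_bigr => -[i /= le_im] _.
rewrite ltnS in le_im.
rewrite !xiX !fcoefZ /= subnKC // !mulrN.
rewrite -[- (v%:R * _)]mulN1r -[- ((w - v)%:R * _)]mulN1r !exprMn !exprVn exprD.
rewrite -[in (-1) ^+ m](subnKC le_im) -[in N%:R ^+ m.+2](subnKC le_im) !exprS !exprD.
by field; rewrite !natr_fact_neq0 !expf_neq0.
Qed.

(** Multiplication by [f] or by [g] yields the mixed products once each, together with [f^w] or
    [g^w] respectively. *)
Lemma sum_xi_telescope (A : comNzRingType) (f g : A) w : (0 < w)%N ->
  (f + g) * \sum_(i < w) f ^+ (w.-1 - i) * g ^+ i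
  = 2 * \sum_(1 <= v < w) f ^+ v * g ^+ (w - v) + (f ^+ w + g ^+ w).
Proof.
case: w => // w _ /=; rewrite mulrDl.
have -> : f * \sum_(i < w.+1) f ^+ (w - i) * g ^+ i
    = \sum_(1 <= v < w.+1) f ^+ v * g ^+ (w.+1 - v) + f ^+ w.+1.
  rewrite big_add1 big_mkord (reindex_inj rev_ord_inj) mulr_sumr big_ord_recr /=.
  rewrite !subSS subnn subn0 expr0 mulr1 -exprS; congr (_ + _).
  apply: eq_bigr => -[i /= lt_iw] _; rewrite !subSS subKn ?[(i <= w)%N]ltnW //.
  by rewrite mulrA -exprS.
have -> : g * \sum_(i < w.+1) f ^+ (w - i) * g ^+ i
    = \sum_(1 <= v < w.+1) f ^+ v * g ^+ (w.+1 - v) + g ^+ w.+1.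
  rewrite big_add1 big_mkord (reindex_inj rev_ord_inj) mulr_sumr big_ord_recl /=.
  rewrite !subSS !subn0 subnn expr0 mul1r -exprS addrC; congr (_ + _).
  apply: eq_bigr => -[i /= lt_iw] _; rewrite !subSS subKn //.
  by rewrite mulrCA -exprS -subSn.
by rewrite mulr2n mulrDl mul1r addrACA.
Qed.

(* Stated over an abstract field: [field] diverges on the coefficients of
   concrete power series over [R[i]]. *)
Lemma stuffle_arith (F : numFieldType) (n p T Au Av Bu Bv U V U1 V1 Y d : F) :
    n != 0 ->
    Au - Av + (Bu - Bv) = p / (2 * n) * (2 * T + (U + V)) ->
    d * Y = d * (- n^-1 * V1) ->
  p * (n ^- 2 * T)
  = - n^-1 * Av - - d / 2 * (- n^-1 * V1) - (- n^-1 * Au - - d / 2 * (- n^-1 * U1))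
    - (- n^-1 * Bu - - d / 2 * (- n^-1 * U1) - (- n^-1 * Bv - - d / 2 * (- n^-1 * V1)))
    + p * ((2 * n)^-1 * (- n^-1 * V + - n^-1 * U)) + d * (- n^-1 * U1 - Y).
Proof.
move=> n_neq0 key dY; rewrite [d * (_ - Y)]mulrBr dY.
transitivity (n^-1 * (Au - Av + (Bu - Bv))
  + p * ((2 * n)^-1 * (- n^-1 * V + - n^-1 * U))).
  by rewrite key; field.
by field.
Qed.

Lemma wgf_delta0 m (c : nat -> C) x y :
  wgf m (fun i j => (i == 0)%N%:R * c j) x y = y ^+ m * c m.
Proof.
rewrite /wgf big_ord_recl big1 ?addr0 => [|i _]; last by rewrite mul0r mulr0.
by rewrite /= !subn0 expr0 !mul1r.
Qed.

Lemma wgf_const m c x y :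
  (x - y) * wgf m (fun _ _ => c) x y = (x ^+ m.+1 - y ^+ m.+1) * c.
Proof.
rewrite /wgf -mulr_suml mulrA subrXX; congr (_ * _ * _).
rewrite (reindex_inj rev_ord_inj); apply: eq_bigr => -[i /= le_im] _.
by rewrite !subSS subKn.
Qed.

(** The factor [x - y] makes [wgf_beta_gcoef] applicable to each half of [mix]. The subtracted terms
    with [beta_0] produce the last summand, present only for [a = b]. *)
Lemma stuffle_diag_wgf m a b x y w : (0 < w)%N ->
  (x - y) * ((N%:R ^+ 2)^-1 * \sum_(1 <= v < w) (xi a x ^+ v * xi b y ^+ (w - v)) m)
  = (x - y) * wgf m (mix a b (gcoef a ^~ w) (gcoef b ^~ w)) x y
    + (x - y) * wgf m (mix b a (gcoef b ^~ w) (gcoef a ^~ w)) y x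
    + (x - y) * ((2 * N%:R)^-1 * (y ^+ m * gcoef b m w + x ^+ m * gcoef a m w))
    + (a == b)%:R * ((x ^+ m.+1 - y ^+ m.+1) * gcoef a m.+1 w).
Proof.
move=> w_gt0; rewrite !wgf_mix.
have -> (u v : C) : (x - y) * (u - v) = (x - y) * u - (x - y) * v by ring.
have -> (u v : C) : (x - y) * (u - v) = - ((y - x) * u - (y - x) * v) by ring.
rewrite !wgf_beta_gcoef !gcoef_xi.
set u := xi a x; set v := xi b y; set A := fps_dil (x - y) _; set A' := fps_dil (y - x) _.
set T := \sum_(1 <= l < w) _; set T0 := \sum_(1 <= l < w) u ^+ l * v ^+ (w - l).
(* Once [u^w - v^w] is factored through [u - v], [beta_xi] evaluates [A (u - v)] and [A' (u - v)] as
   the same multiple of [t v] and of [t u]; their sum meets the geometric sum through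
   [sum_xi_telescope]. *)
have key : (A + A') * (u ^+ w - v ^+ w)
    = ((x - y) / (2 * N%:R)) *: (fps_X C * (2 * T0 + (u ^+ w + v ^+ w))).
  rewrite -sum_xi_telescope // subrXX mulrA mulrDl.
  have -> : A' * (u - v) = ((x - y) / (2 * N%:R)) *: (fps_X C * u).
    by rewrite -opprB mulrN beta_xi -scaleNr; congr (_ *: _); ring.
  rewrite beta_xi -scalerDr -mulrDr -scalerAl.
  by rewrite -[fps_X C * _ * _]mulrA [v + u]addrC.
have {}key := fps_coef_key m key.
rewrite /T -fcoef_sum -/T0 {T} [(_ - _) * gcoef _ _ _]mulrBl gcoef_xi.
rewrite !beta0 // !subr_eq0 [b == a]eq_sym.
have eqV : (a == b)%:R * (y ^+ m.+1 * gcoef a m.+1 w)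
    = (a == b)%:R * (- N%:R^-1 * (v ^+ w) m.+1).
  by case: eqVneq => [->|_]; rewrite ?mul0r // gcoef_xi.
exact: (stuffle_arith _ N_neq0 key eqV).
Qed.

(** Obtained from [stuffle_diag_wgf] by cancelling [x - y] for distinct [x] and [y] and comparing
    coefficients. *)
Lemma stuffle_diag_coef a b r s w : (0 < w)%N ->
  (-1) ^+ (r + s) / (N%:R ^+ (r + s).+2 * r`!%:R * s`!%:R) *
     \sum_(1 <= v < w) ee ^+ (a * v + b * (w - v)) * v%:R ^+ r * (w - v)%:R ^+ s
  = mix a b (gcoef a ^~ w) (gcoef b ^~ w) r s
    + mix b a (gcoef b ^~ w) (gcoef a ^~ w) s r
    + (2 * N%:R)^-1 * ((r == 0)%N%:R * gcoef b s w + (s == 0)%N%:R * gcoef a r w)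
    + (a == b)%:R * gcoef a (r + s).+1 w.
Proof.
move=> w_gt0; set m := (r + s)%N.
pose c r s := (-1) ^+ (r + s) / (N%:R ^+ (r + s).+2 * r`!%:R * s`!%:R) *
  \sum_(1 <= v < w) ee ^+ (a * v + b * (w - v)) * v%:R ^+ r * (w - v)%:R ^+ s : C.
pose d r s : C := mix a b (gcoef a ^~ w) (gcoef b ^~ w) r s
    + mix b a (gcoef b ^~ w) (gcoef a ^~ w) s r
    + (2 * N%:R)^-1 * ((r == 0)%N%:R * gcoef b s w + (s == 0)%N%:R * gcoef a r w)
    + (a == b)%:R * gcoef a m.+1 w.
apply: (@wgf_inj _ m c d _ r s erefl) => x y neq_xy.
apply: (mulfI (x := x - y)); first by rewrite subr_eq0.
rewrite wgf_diag stuffle_diag_wgf // !wgfD.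
rewrite (wgfZ _ _ (fun _ _ => gcoef a m.+1 w)) (wgfZ _ (2 * N%:R)^-1) wgfD.
rewrite !mulrDr wgf_delta0 (wgfC _ (mix b a _ _)).
rewrite (wgfC _ (fun j i => (j == 0)%N%:R * gcoef a i w)) wgf_delta0.
congr (_ + _); by rewrite [RHS]mulrCA wgf_const.
Qed.

End Stuffle.

(** * Double sums split along the diagonal *)

Section TriangularSums.
Variable V : nmodType.
Implicit Types (f : nat -> nat -> V) (M : nat).

Lemma sum_nat_square f M :
  \sum_(1 <= i < M) \sum_(1 <= j < M) f i j
  = \sum_(1 <= i < M) \sum_(1 <= j < i) f i j
    + \sum_(1 <= j < M) \sum_(1 <= i < j) f i j + \sum_(1 <= i < M) f i i.
Proof.
have lower (g : nat -> nat -> V) : \sum_(1 <= i < M) \sum_(1 <= j < i) g i j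
    = \sum_(1 <= i < M) \sum_(1 <= j < M | (j < i)%N) g i j.
  by apply: eq_big_nat => i /andP[_ lt_iM]; rewrite (big_nat_widen _ _ M) // ltnW.
rewrite lower (lower (fun j i => f i j)) [X in _ + X + _](exchange_big_dep xpredT) //=.
rewrite -!big_split /=; apply: eq_big_nat => i i_bounds.
rewrite (bigID (fun j => (j < i)%N)) /= -addrA; congr (_ + _).
rewrite (bigID (pred1 i)) /= addrC; congr (_ + _).
  by apply: eq_bigl => j; rewrite -leqNgt andbC ltn_neqAle eq_sym.
rewrite (eq_bigl (pred1 i)) => [|j /=]; last first.
  by case: eqP => [->|]; rewrite ?ltnn // andbF.
by rewrite -big_filter filter_pred1_uniq ?iota_uniq ?mem_index_iota // big_seq1.
Qed.

(** The substitution [i = j + d]; the vanishing hypothesis lets [d] run over a range independent of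
    [j]. *)
Lemma sum_nat_lower f M : (forall i j, (M <= i)%N -> f i j = 0) ->
  \sum_(1 <= i < M) \sum_(1 <= j < i) f i j
  = \sum_(1 <= j < M) \sum_(1 <= d < M) f (j + d)%N j.
Proof.
move=> f0.
transitivity (\sum_(1 <= i < M) \sum_(1 <= j < M | (j < i)%N) f i j).
  by apply: eq_big_nat => i /andP[_ lt_iM]; rewrite (big_nat_widen _ _ M) // ltnW.
rewrite (exchange_big_dep xpredT) //=; apply: eq_big_nat => j /andP[j_gt0 lt_jM].
transitivity (\sum_(1 + j <= i < M) f i j).
  by rewrite [RHS](big_nat_widenl _ 1%N) ?leq_addr.
rewrite big_addn [RHS](@big_cat_nat _ _ _ (M - j)) ?subn_gt0 ?leq_subr //=.
rewrite [X in _ + X]big_nat_cond [X in _ + X]big1 ?addr0 => [|d].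
  by apply: eq_bigr => d _; rewrite addnC.
by rewrite andbT => /andP[le_d _]; rewrite f0 // -leq_subLR.
Qed.

End TriangularSums.

(** * Two splittings of a product of single sums *)

Section DoubleSums.
Variable R : realType.
Local Notation C := R[i].
Implicit Types (c d : nat -> nat -> C) (F : nat -> nat -> C) (n M u v w : nat).

(** The analogue of [qsum4] without an ordering of [u1] and [u2]. *)
Definition qprod F : fps C := \fps_n \sum_(1 <= u1 < n.+1) \sum_(1 <= u2 < n.+1)
  \sum_(1 <= v1 < n.+1) \sum_(1 <= v2 < n.+1 | (u1 * v1 + u2 * v2 == n)%N) F v1 v2.

Lemma eq_qsum2 c d : (forall u v, (0 < u)%N -> (0 < v)%N -> c u v = d u v) ->
  qsum2 c = qsum2 d.
Proof.
move=> eq_cd; apply/fpsP => n; apply: eq_big_nat => u /andP[u_gt0 _].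
rewrite big_nat_cond [RHS]big_nat_cond.
by apply: eq_bigr => v /andP[/andP[v_gt0 _] _]; exact: eq_cd.
Qed.

Lemma qsum2_widen c n M : (n < M)%N ->
  qsum2 c n = \sum_(1 <= u < M) \sum_(1 <= v < M | (u * v == n)%N) c u v.
Proof.
move=> lt_nM.
rewrite [RHS](@big_cat_nat _ _ _ n.+1) //= [X in _ + X]big_nat_cond.
rewrite [X in _ + X]big1 ?addr0 => [|u]; last first.
  rewrite andbT => /andP[lt_nu _]; rewrite big_nat_cond big1 // => v.
  by case/andP => /andP[v_gt0 _] /eqP; nia.
apply: eq_big_nat => u /andP[u_gt0 _].
rewrite [RHS](@big_cat_nat _ _ _ n.+1) //= [X in _ + X]big_nat_cond.
rewrite [X in _ + X]big1 ?addr0 // => v /andP[/andP[lt_nv _] /eqP]; nia.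
Qed.

Lemma qsum2M (c d : nat -> C) :
  qsum2 (fun _ v => c v) * qsum2 (fun _ v => d v) = qprod (fun v1 v2 => c v1 * d v2).
Proof.
apply/fpsP => n; rewrite fcoefM.
(* Written with indicators, the Cauchy index [j] can be summed innermost, where only [j = u1 v1]
   survives. *)
transitivity (\sum_(1 <= u1 < n.+1) \sum_(1 <= u2 < n.+1) \sum_(1 <= v1 < n.+1)
    \sum_(1 <= v2 < n.+1) \sum_(j < n.+1) 
      ((u1 * v1 == j)%N%:R * (u2 * v2 == n - j)%N%:R) * (c v1 * d v2)).
  transitivity (\sum_(j < n.+1) \sum_(1 <= u1 < n.+1) \sum_(1 <= u2 < n.+1)
    \sum_(1 <= v1 < n.+1) \sum_(1 <= v2 < n.+1)
      ((u1 * v1 == j)%N%:R * (u2 * v2 == n - j)%N%:R) * (c v1 * d v2)).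
    apply: eq_bigr => j _; rewrite !(@qsum2_widen _ _ n.+1) // ?ltnS ?leq_subr //.
    rewrite mulr_suml; apply: eq_bigr => u1 _.
    rewrite mulr_sumr; apply: eq_bigr => u2 _.
    rewrite big_mkcond mulr_suml; apply: eq_bigr => v1 _.
    rewrite big_mkcond mulr_sumr; apply: eq_bigr => v2 _.
    by case: (_ == j :> nat); case: (_ == _); rewrite ?(mul0r, mulr0, mul1r, mulr1).
  rewrite exchange_big /=; apply: eq_bigr => u1 _.
  rewrite exchange_big /=; apply: eq_bigr => u2 _.
  rewrite exchange_big /=; apply: eq_bigr => v1 _.
  by rewrite exchange_big.
apply: eq_bigr => u1 _; apply: eq_bigr => u2 _; apply: eq_bigr => v1 _.
rewrite [RHS]big_mkcond; apply: eq_bigr => v2 _.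
case: eqP => [uvn|neq_uvn].
  have lt_uv : (u1 * v1 < n.+1)%N by rewrite ltnS -uvn leq_addr.
  rewrite (bigD1 (Ordinal lt_uv)) //= -[X in (_ == X - _)%N]uvn addKn !eqxx !mul1r.
  rewrite big1 ?addr0 // => j; rewrite -val_eqE /= eq_sym => /negPf ->.
  by rewrite !mul0r.
rewrite big1 // => -[j /= le_jn] _; case: eqP => [eq_j|]; last by rewrite !mul0r.
case: eqP => [eq_nj|]; last by rewrite mulr0 mul0r.
by case: neq_uvn; rewrite eq_j eq_nj subnKC.
Qed.

(** On the diagonal [u1 = u2 = u] the exponent is [u (v1 + v2)], and grouping by [w = v1 + v2]
    leaves a single sum. *)
Lemma qprod_stuffle F :
  qprod F = qsum4 F + qsum4 (fun v1 v2 => F v2 v1)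
    + qsum2 (fun _ w => \sum_(1 <= v < w) F v (w - v)%N).
Proof.
apply/fpsP => n; rewrite !fcoefD [LHS]/= sum_nat_square; congr (_ + _ + _).
  apply: eq_bigr => u2 _; apply: eq_bigr => u1 _.
  rewrite (exchange_big_dep xpredT) //=; apply: eq_bigr => v2 _.
  by apply: eq_bigl => v1; rewrite addnC.
apply: eq_big_nat => u /andP[u_gt0 _].
transitivity (\sum_(1 <= v1 < n.+1) \sum_(1 <= v2 < n.+1)
   if (u * (v1 + v2) == n)%N then F v1 (v1 + v2 - v1)%N else 0).
  apply: eq_bigr => v1 _; rewrite big_mkcond; apply: eq_bigr => v2 _.
  by rewrite mulnDr addKn.
rewrite -(@sum_nat_lower _ (fun w v => if (u * w == n)%N then F v (w - v)%N else 0)).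
  rewrite [RHS]big_mkcond; apply: eq_bigr => w _.
  by case: ifP => // _; rewrite big1.
by move=> w v lt_nw; case: eqP => //; nia.
Qed.

(** For [v1 = v2 + d] the exponent is [(u1 + u2) v2 + u1 d], again of the form in [qsum4]; the case
    [v1 < v2] is symmetric. For [v1 = v2] only [u = u1 + u2] matters, and it arises in [u - 1]
    ways. *)
Lemma qprod_shuffle F :
  qprod F = qsum4 (fun v1 v2 => F v1 (v1 + v2)%N) + qsum4 (fun v1 v2 => F (v1 + v2)%N v1)
    + qsum2 (fun u v => u.-1%:R * F v v).
Proof.
apply/fpsP => n; rewrite !fcoefD.
(* The condition on the exponent moves into the summand, so that all four sums can be exchanged
   freely. *)
pose G u1 u2 v1 v2 (x : C) := if (u1 * v1 + u2 * v2 == n)%N then x else 0.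
have GE u1 u2 (E : nat -> nat -> C) :
    \sum_(1 <= v1 < n.+1) \sum_(1 <= v2 < n.+1 | (u1 * v1 + u2 * v2 == n)%N) E v1 v2
    = \sum_(1 <= v1 < n.+1) \sum_(1 <= v2 < n.+1) G u1 u2 v1 v2 (E v1 v2).
  by apply: eq_bigr => v1 _; rewrite big_mkcond.
have qsum4E E : qsum4 E n = \sum_(1 <= v1 < n.+1) \sum_(1 <= v2 < n.+1)
    \sum_(1 <= u < n.+1) \sum_(1 <= d < n.+1) G (u + d)%N u v1 v2 (E v1 v2).
  rewrite [LHS]/=; under eq_bigr do under eq_bigr do rewrite GE.
  rewrite sum_nat_lower => [|u1 u2 lt_nu]; last first.
    rewrite big_nat_cond big1 // => v1 /andP[/andP[v1_gt0 _] _].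
    by rewrite big1 // => v2 _; rewrite /G; case: eqP => //; nia.
  under eq_bigr do rewrite exchange_big /=.
  rewrite exchange_big /=; apply: eq_bigr => v1 _.
  under eq_bigr do rewrite exchange_big /=.
  by rewrite exchange_big.
transitivity (\sum_(1 <= v1 < n.+1) \sum_(1 <= v2 < n.+1)
    \sum_(1 <= u1 < n.+1) \sum_(1 <= u2 < n.+1) G u1 u2 v1 v2 (F v1 v2)).
  rewrite [LHS]/=; under eq_bigr do under eq_bigr do rewrite GE.
  under eq_bigr do rewrite exchange_big /=.
  rewrite exchange_big /=; apply: eq_bigr => v1 _.
  under eq_bigr do rewrite exchange_big /=.
  by rewrite exchange_big.
have G0 u1 u2 v1 v2 x : (0 < u1)%N -> (0 < u2)%N ->
    (n < v1)%N || (n < v2)%N -> G u1 u2 v1 v2 x = 0.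
  by rewrite /G => ? ? ?; case: eqP => //; nia.
have sum0 v1 v2 (x : C) : (n < v1)%N || (n < v2)%N ->
    \sum_(1 <= u1 < n.+1) \sum_(1 <= u2 < n.+1) G u1 u2 v1 v2 x = 0.
  move=> lt_n; rewrite big_nat_cond big1 // => u1 /andP[/andP[u1_gt0 _] _].
  by rewrite big_nat_cond big1 // => u2 /andP[/andP[u2_gt0 _] _]; exact: G0.
rewrite sum_nat_square addrC [X in _ + X]addrC [RHS]addrC; congr (_ + (_ + _)).
- rewrite [RHS]/=; under [RHS]eq_bigr do rewrite big_mkcond.
  rewrite [RHS]exchange_big /=; apply: eq_big_nat => v /andP[v_gt0 _].
  transitivity (\sum_(1 <= u < n.+1) \sum_(1 <= u2 < u)
      if (u * v == n)%N then F v v else 0).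
    rewrite (@sum_nat_lower _ (fun u _ => if (u * v == n)%N then F v v else 0)).
      by apply: eq_bigr => u1 _; apply: eq_bigr => u2 _; rewrite /G mulnDl.
    by move=> u _ lt_nu; case: eqP => //; nia.
  apply: eq_bigr => u _; rewrite sumr_const_nat subn1.
  by case: ifP => _; rewrite ?mul0rn // mulr_natl.
- rewrite qsum4E (@sum_nat_lower _ (fun v2 v1 => \sum_(1 <= u1 < n.+1)
    \sum_(1 <= u2 < n.+1) G u1 u2 v1 v2 (F v1 v2))) => [|v2 v1 lt_nv]; last first.
    by rewrite sum0 ?lt_nv ?orbT.
  apply: eq_bigr => v1 _; apply: eq_bigr => v2 _; rewrite exchange_big.
  apply: eq_bigr => u _; apply: eq_bigr => d _; congr (if _ == _ then _ else _); ring.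
- rewrite qsum4E (@sum_nat_lower _ (fun v1 v2 => \sum_(1 <= u1 < n.+1)
    \sum_(1 <= u2 < n.+1) G u1 u2 v1 v2 (F v1 v2))) => [|v1 v2 lt_nv]; last first.
    by rewrite sum0 ?lt_nv.
  apply: eq_bigr => v1 _; apply: eq_bigr => v2 _.
  apply: eq_bigr => u _; apply: eq_bigr => d _; congr (if _ == _ then _ else _); ring.
Qed.

End DoubleSums.

(** * Stuffle and shuffle formulas for products of [gtilde] *)

Section DoubleShuffle.
Variables (R : realType) (N : nat).
Hypothesis N_gt0 : (0 < N)%N.
Local Notation C := R[i].
Local Notation ee := (eta R N).
Local Notation g a j n := (gtilde R a j.+1 n).
Implicit Types (a b : Zmod N) (x y : C) (m n i j r s v w : nat).
Implicit Types (c d : nat -> nat -> C).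

Let N_neq0 : (N%:R : C) != 0. Proof. by rewrite pnatr_eq0 -lt0n. Qed.

Lemma qsum2D c d n : qsum2 (fun u v => c u v + d u v) n = qsum2 c n + qsum2 d n.
Proof.
rewrite /= -big_split; apply: eq_bigr => u _ /=.
by rewrite -big_split.
Qed.

Lemma qsum2Z k c n : qsum2 (fun u v => k * c u v) n = k * qsum2 c n.
Proof.
rewrite /= mulr_sumr; apply: eq_bigr => u _.
by rewrite mulr_sumr.
Qed.

Lemma qsum2_sum (I : Type) (t : seq I) (c : I -> nat -> nat -> C) n :
  qsum2 (fun u v => \sum_(k <- t) c k u v) n = \sum_(k <- t) qsum2 (c k) n.
Proof.
rewrite /= [RHS]exchange_big; apply: eq_bigr => u _ /=.
by rewrite [RHS]exchange_big.
Qed.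

Lemma wgf_qprod m (F : nat -> nat -> nat -> nat -> C) x y n :
  wgf m (fun i j => qprod (F i j) n) x y
  = qprod (fun v1 v2 => wgf m (fun i j => F i j v1 v2) x y) n.
Proof.
rewrite /= wgf_sum; apply: eq_bigr => u1 _; rewrite wgf_sum; apply: eq_bigr => u2 _.
rewrite wgf_sum; apply: eq_bigr => v1 _; exact: wgf_sum.
Qed.

Lemma wgf_qsum4 m (F : nat -> nat -> nat -> nat -> C) x y n :
  wgf m (fun i j => qsum4 (F i j) n) x y
  = qsum4 (fun v1 v2 => wgf m (fun i j => F i j v1 v2) x y) n.
Proof.
rewrite /= wgf_sum; apply: eq_bigr => u1 _; rewrite wgf_sum; apply: eq_bigr => u2 _.
rewrite wgf_sum; apply: eq_bigr => v1 _; exact: wgf_sum.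
Qed.

Lemma gtildeE a j : gtilde R a j.+1 = qsum2 (fun _ v => gcoef R a j v).
Proof. by apply/fpsP => n; rewrite fcoefZ -qsum2Z. Qed.

Lemma gcoefM a b r s v1 v2 : gcoef R a r v1 * gcoef R b s v2
  = (-1) ^+ (r + s) / (N%:R ^+ (r + s).+2 * r`!%:R * s`!%:R)
    * (ee ^+ (a * v1 + b * v2) * v1%:R ^+ r * v2%:R ^+ s).
Proof.
rewrite /gcoef !exprS !exprD; field.
by rewrite !natr_fact_neq0 !expf_neq0.
Qed.

Lemma gtilde2E a b r s : gtilde2 R a b r.+1 s.+1
  = qsum4 (fun v1 v2 => gcoef R a r v1 * gcoef R b s v2).
Proof.
apply/fpsP => n; rewrite fcoefZ /= addSn addnS !exprS !mulN1r opprK mulr_sumr.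
apply: eq_bigr => u1 _; rewrite mulr_sumr; apply: eq_bigr => u2 _.
rewrite mulr_sumr; apply: eq_bigr => v1 _; rewrite mulr_sumr; apply: eq_bigr => v2 _.
by rewrite gcoefM !exprS.
Qed.

Lemma beta2E a b r s n : beta2 R a b r.+1 s.+1 n
  = beta R b s.+1 * g a r n + mix a b (fun j => g a j n) (fun j => g b j n) r s.
Proof.
rewrite fcoefD fcoefZ fcoef_sum big_add1 addSn addnS succnK big_mkord; congr (_ + _).
apply: eq_bigr => i _; have le_i := ltn_ord i.
rewrite fcoefZ fcoefD !fcoefZ; congr (_ * _).
rewrite subSS subSn // !succnK; cbv beta.
have -> : (-1) ^+ s.+1 = - (-1) ^+ s :> C by rewrite exprS mulN1r.
(* The exponent [i - r] is an integer in [beta2] and a truncated difference in [mix]; they differ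
   only for [i < r], where the binomial vanishes. *)
have [lt_ir|le_ri] := ltnP i r; first by rewrite (bin_small lt_ir); ring.
have -> : i.+1%:Z - r.+1%:Z = (i - r)%N%:Z by rewrite subzSS subzn.
by rewrite -exprnP; ring.
Qed.

Lemma gtildeM a b r s : gtilde R a r.+1 * gtilde R b s.+1
  = qprod (fun v1 v2 => gcoef R a r v1 * gcoef R b s v2).
Proof. by rewrite !gtildeE qsum2M. Qed.

Lemma stuffle_gtilde a b r s n : (gtilde R a r.+1 * gtilde R b s.+1) n
  = gtilde2 R a b r.+1 s.+1 n + gtilde2 R b a s.+1 r.+1 n
    + (mix a b (fun j => g a j n) (fun j => g b j n) r s
    + mix b a (fun j => g b j n) (fun j => g a j n) s r
    + (2 * N%:R)^-1 * ((r == 0)%N%:R * g b s n + (s == 0)%N%:R * g a r n)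
    + (a == b)%:R * g a (r + s).+1 n).
Proof.
rewrite gtildeM qprod_stuffle !fcoefD !gtilde2E; congr (_ + _ + _).
  by do 4![apply: eq_bigr => ? _]; rewrite mulrC.
(* As [mix] is linear in its two sequences, it commutes with the summation over [u] and [w]. *)
have mixE a' b' (r' s' : nat) :
    qsum2 (fun _ w => mix a' b' (gcoef R a' ^~ w) (gcoef R b' ^~ w) r' s') n
    = mix a' b' (fun j => g a' j n) (fun j => g b' j n) r' s'.
  rewrite qsum2_sum; apply: eq_bigr => i _; rewrite qsum2Z; congr (_ * _).
  rewrite !gtildeE -mulNr -!qsum2Z -qsum2D.
  by apply: eq_bigr => u _; apply: eq_bigr => v _; rewrite mulNr.
rewrite -!mixE !gtildeE -!qsum2Z -[X in (2 * N%:R)^-1 * X]qsum2D -qsum2Z -!qsum2D.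
congr (fcoef _ n); apply: eq_qsum2 => _ w _ w_gt0.
rewrite -stuffle_diag_coef // mulr_sumr; apply: eq_bigr => v _; exact: gcoefM.
Qed.


Lemma wgf_shuffle m c x y :
  wgf m (fun r s => \sum_(i < (r + s).+1) 'C(i, r)%:R * c i (r + s - i)%N) x y
  = wgf m c (x + y) y.
Proof.
rewrite -[in RHS](mul1r x) -[X in _ = wgf _ _ (_ + X) _](mul1r y) -wgf_subst.
by apply: eq_wgf => r s _; apply: eq_bigr => i _; rewrite !expr1n !mulr1.
Qed.

Lemma wgf_shuffleC m c x y :
  wgf m (fun r s => \sum_(i < (r + s).+1) 'C(i, s)%:R * c i (r + s - i)%N) x y
  = wgf m c (x + y) x.
Proof.
rewrite addrC -wgf_shuffle -[RHS]wgfC; apply: eq_wgf => r s _.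
by rewrite addnC.
Qed.

Lemma wgf_binomial m (k : C) x y :
  wgf m (fun r s => 'C(r + s, r)%:R * k) x y = (x + y) ^+ m * k.
Proof.
rewrite addrC exprDn mulr_suml; apply: eq_bigr => -[i /= le_im] _.
by rewrite ltnS in le_im; rewrite subnKC // -mulr_natl; ring.
Qed.

(** As [x] and [y] enter only through [v1 x + v2 y], a linear substitution in them can be traded for
    one in [v1] and [v2]. *)
Definition monom m v1 v2 a b x y : C := (-1) ^+ m / (N%:R ^+ m.+2 * m`!%:R) *
  (ee ^+ (a * v1) * ee ^+ (b * v2) * (v1%:R * x + v2%:R * y) ^+ m).

Lemma wgf_gcoefM m a b v1 v2 x y :
  wgf m (fun i j => gcoef R a i v1 * gcoef R b j v2) x y = monom m v1 v2 a b x y.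
Proof.
rewrite /monom [_ * x + _]addrC exprDn !mulr_sumr; apply: eq_bigr => -[i /= le_im] _.
rewrite ltnS in le_im; rewrite gcoefM subnKC // -[_ *+ 'C(m, i)]mulr_natl exprD !exprMn.
have -> : 'C(m, i)%:R = m`!%:R / (i`!%:R * (m - i)`!%:R) :> C.
  by rewrite divr_fact subnKC // mulrCA divff ?natr_fact_neq0 ?mulr1.
by field; rewrite !natr_fact_neq0 expf_neq0.
Qed.

(** The identity [v1 x + (v1 + v2) y = v1 (x + y) + v2 y], and likewise for the roots of unity,
    turns the two halves of [qprod_shuffle] into the substitutions [(x + y, y)] and [(x + y, x)]. In
    the diagonal factor [u - 1], the part [u] gives [dgtilde] and the part [- 1] gives [gtilde]. *)
Lemma shuffle_gtilde a b r s n : (gtilde R a r.+1 * gtilde R b s.+1) n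
  = \sum_(i < (r + s).+1) 'C(i, r)%:R * gtilde2 R (a + b) b i.+1 (r + s - i).+1 n
    + \sum_(i < (r + s).+1) 'C(i, s)%:R * gtilde2 R (a + b) a i.+1 (r + s - i).+1 n
    + 'C(r + s, r)%:R * (N%:R^-1 * (dgtilde R (a + b) (r + s) n + g (a + b) (r + s) n)).
Proof.
set m := (r + s)%N.
pose c1 i j := (gtilde R a i.+1 * gtilde R b j.+1) n.
pose c2 r s : C :=
    \sum_(i < (r + s).+1) 'C(i, r)%:R * gtilde2 R (a + b) b i.+1 (r + s - i).+1 n
    + \sum_(i < (r + s).+1) 'C(i, s)%:R * gtilde2 R (a + b) a i.+1 (r + s - i).+1 n
    + 'C(r + s, r)%:R * (N%:R^-1 * (dgtilde R (a + b) m n + g (a + b) m n)).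
apply: (@wgf_inj _ m c1 c2 _ r s erefl) => x y _.
rewrite !wgfD wgf_binomial.
rewrite (wgf_shuffle _ (fun i j => gtilde2 R (a + b) b i.+1 j.+1 n)).
rewrite (wgf_shuffleC _ (fun i j => gtilde2 R (a + b) a i.+1 j.+1 n)).
under eq_wgf do rewrite /c1 gtildeM.
under [X in _ = X + _ + _]eq_wgf do rewrite gtilde2E.
under [X in _ = _ + X + _]eq_wgf do rewrite gtilde2E.
rewrite wgf_qprod !wgf_qsum4 qprod_shuffle !fcoefD; congr (_ + _ + _).
- do 3![apply: eq_bigr => ? _]; apply: eq_bigr => v _.
  rewrite !wgf_gcoefM /monom eta_add // natrD mulnDr exprD.
  by congr (_ * (_ * _ ^+ _)); [rewrite mulrA | ring].
- do 3![apply: eq_bigr => ? _]; apply: eq_bigr => v _.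
  rewrite !wgf_gcoefM /monom eta_add // natrD mulnDr exprD.
  by congr (_ * (_ * _ ^+ _)); [rewrite mulrAC | ring].
rewrite gtildeE /dgtilde fcoefZ -qsum2Z -qsum2D -!qsum2Z.
congr (fcoef _ n); apply: eq_qsum2 => u v u_gt0 _.
rewrite wgf_gcoefM /monom /gcoef eta_add // -mulrDr exprMn.
rewrite -[in RHS](prednK u_gt0) -natr1 !exprS.
by field; rewrite natr_fact_neq0 expf_neq0.
Qed.

(** After the substitutions the first halves of the two [mix] terms are the left-hand side, as
    [a + b - b = a] and [x + y - y = x]; every term with [gtilde (a + b)] cancels against one from
    the other sum. *)
Lemma shuffle_beta a b r s n :
  beta R a r.+1 * g b s n + beta R b s.+1 * g a r n
  = \sum_(i < (r + s).+1) 'C(i, r)%:R * beta2 R (a + b) b i.+1 (r + s - i).+1 n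
    + \sum_(i < (r + s).+1) 'C(i, s)%:R * beta2 R (a + b) a i.+1 (r + s - i).+1 n.
Proof.
pose c1 r s := beta R a r.+1 * g b s n + beta R b s.+1 * g a r n.
pose c2 r s : C :=
    \sum_(i < (r + s).+1) 'C(i, r)%:R * beta2 R (a + b) b i.+1 (r + s - i).+1 n
    + \sum_(i < (r + s).+1) 'C(i, s)%:R * beta2 R (a + b) a i.+1 (r + s - i).+1 n.
apply: (@wgf_inj _ (r + s) c1 c2 _ r s erefl) => x y _.
rewrite !wgfD.
rewrite (wgf_shuffle _ (fun i j => beta2 R (a + b) b i.+1 j.+1 n)).
rewrite (wgf_shuffleC _ (fun i j => beta2 R (a + b) a i.+1 j.+1 n)).
under [X in _ = X + _]eq_wgf do rewrite beta2E.
under [X in _ = _ + X]eq_wgf do rewrite beta2E.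
rewrite !wgfD !wgf_mix !addrK [x + y - x]addrC addKr [a + b - a]addrC addKr.
rewrite (wgfC _ (fun i j => beta R b i.+1 * g a j n)).
rewrite (wgfC _ (fun i j => beta R b i.+1 * g (a + b) j n)).
rewrite (wgfC _ (fun i j => beta R a i.+1 * g (a + b) j n)).
have cancel (A B A' B' : C) : A + B = A' + (A - B') + (B' + (B - A')) by ring.
exact: cancel.
Qed.

End DoubleShuffle.

(** * The regularised relations *)

(** Only [i = 0], [i = 1] and [i = r + s] contribute. For [r = 0] the [D] terms at [i = 0] and
    [i = 1] cancel when [s > 0]; for [s = 0] the index [1] is out of range and [- D 0] remains. *)
Lemma sum_bin_boundary (F : comNzRingType) (D X : nat -> F) (k l : F) (r s : nat) :
  \sum_(i < (r + s).+1) 'C(i, r)%:R *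
     ((i == 1 :> nat)%:R * D (r + s - i).+1%N - (i == 0 :> nat)%:R * D (r + s - i)%N
      + (r + s - i == 0)%N%:R * X i
      + k * ((i == 0 :> nat)%:R * (r + s - i == 0)%N%:R) * l)
  = (r == 1)%N%:R * D s.+1 - (r == 0)%N%:R * (s == 0)%N%:R * D 0%N
    + 'C(r + s, r)%:R * X (r + s)%N + k * ((r == 0)%N%:R * (s == 0)%N%:R) * l.
Proof.
under eq_bigr do rewrite 2!mulrDr.
rewrite !big_split /=; congr (_ + _ + _).
- rewrite big_ord_recl bin0n subn0.
  case: r => [|r]; last first.
    rewrite addSn big_ord_recl big1 => [|i _].
      rewrite !lift0 subSS subn0; case: r => [|r].
        by rewrite add0n bin1 /=; ring.
      by rewrite bin_small //=; ring.
    by rewrite lift0 /= !mul0r subr0 mulr0.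
  rewrite add0n; case: s => [|s]; first by rewrite big_ord0 /=; ring.
  rewrite big_ord_recl big1 => [|i _].
    by rewrite !lift0 subSS subn0 bin0 /=; ring.
  by rewrite lift0 /= !mul0r subr0 mulr0.
- rewrite big_ord_recr /= subnn eqxx mul1r big1 ?add0r // => i _.
  by rewrite subn_eq0 leqNgt ltn_ord /= mul0r mulr0.
rewrite big_ord_recl big1 ?addr0 => [|i _].
  by rewrite /= subn0 bin0n addn_eq0; case: (r == 0%N) => /=; ring.
by rewrite /= !mul0r !mulr0 mul0r mulr0.
Qed.

Section Relations.
Variables (R : realType) (N : nat).
Hypothesis N_gt0 : (0 < N)%N.
Local Notation C := R[i].
Local Notation ee := (eta R N).
Local Notation g a j n := (gtilde R a j.+1 n).
Implicit Types (a b : Zmod N) (n i j r s : nat).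

Let N_neq0 : (N%:R : C) != 0. Proof. by rewrite pnatr_eq0 -lt0n. Qed.

(** This is how [f2] enters: [dgtilde _ 0] is left over in weight two. *)
Lemma dgtilde0 a : dgtilde R a 0 = N%:R *: f2 R a.
Proof.
rewrite /dgtilde /f2 scalerA; apply/fpsP => n; rewrite !fcoefZ.
congr (_ * _); first by rewrite fact0 expr0 expr1 mulr1; field.
by apply: eq_bigr => u _; apply: eq_bigr => v _; rewrite expr0 mulr1 mulrC.
Qed.

Section Regularization.
Variables gam lam : Zmod N -> Zmod N -> fps C.

Lemma epsilonE a b r s n : epsilon gam a b r.+1 s.+1 n
  = (r == 1)%N%:R * dgtilde R b s.+1 n - (r == 0)%N%:R * dgtilde R b s n
    + (s == 0)%N%:R * (dgtilde R a r n + g a r n)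
    + N%:R * ((r == 0)%N%:R * (s == 0)%N%:R) * gam a b n.
Proof. by rewrite /epsilon !fcoefD fcoefN !fcoefZ fcoefD !succnK !eqSS (mulrA N%:R). Qed.

Lemma sum_bin_epsilon a b r s n :
  \sum_(i < (r + s).+1) 'C(i, r)%:R * epsilon gam a b i.+1 (r + s - i).+1 n
  = (r == 1)%N%:R * dgtilde R b s.+1 n
    - (r == 0)%N%:R * (s == 0)%N%:R * dgtilde R b 0 n
    + 'C(r + s, r)%:R * (dgtilde R a (r + s) n + g a (r + s) n)
    + N%:R * ((r == 0)%N%:R * (s == 0)%N%:R) * gam a b n.
Proof.
under eq_bigr do rewrite epsilonE.
exact: (sum_bin_boundary (fun j => dgtilde R b j n)
  (fun j => dgtilde R a j n + g a j n) N%:R (gam a b n)).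
Qed.

Lemma E2_coef a b r s n : E2 gam a b r s n
  = gtilde2 R a b r s n + beta2 R a b r s n + (2 * N%:R)^-1 * epsilon gam a b r s n.
Proof. by []. Qed.

Lemma P2_coef a b r s n : P2 lam a b r.+1 s.+1 n
  = (gtilde R a r.+1 * gtilde R b s.+1) n
    + beta R a r.+1 * g b s n + beta R b s.+1 * g a r n
    + (2 * N%:R)^-1 * ((r == 1)%N%:R * dgtilde R b s.+1 n
        + (s == 1)%N%:R * dgtilde R a r.+1 n)
    + (r == 0)%N%:R * (s == 0)%N%:R * lam a b n.
Proof. by []. Qed.

Hypothesis suit : suitable gam lam.

Lemma stuffle_E2 a b r s : P2 lam a b r.+1 s.+1
  = E2 gam a b r.+1 s.+1 + E2 gam b a s.+1 r.+1 + (a == b)%:R *: E1 R a (r.+1 + s.+1).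
Proof.
case: suit => lamC gam_diag gam_off _; apply/fpsP => n.
(* [E1] differs from [gtilde] here only in weight two, where it is zero; the missing [gtilde a 2] is
   supplied by the diagonal equation of [suitable]. *)
have E1E : (a == b)%:R * E1 R a (r.+1 + s.+1) n
      + (a == b)%:R * ((r == 0)%N%:R * (s == 0)%N%:R) * g a 1 n
    = (a == b)%:R * g a (r + s).+1 n.
  rewrite /E1 addSn addnS !ltnS.
  by case: r s => [|r] [|s] /=; rewrite ?mulr0 ?mul0r; ring.
have gamE : (r == 0)%N%:R * (s == 0)%N%:R * lam a b n
    = (2 * N%:R)^-1 * (N%:R * ((r == 0)%N%:R * (s == 0)%N%:R) * gam a b n
        + N%:R * ((s == 0)%N%:R * (r == 0)%N%:R) * gam b a n)
      - (a == b)%:R * ((r == 0)%N%:R * (s == 0)%N%:R) * g a 1 n.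
  have [<-|neq_ab] := eqVneq a b.
    have /fpsP/(_ n) := gam_diag a; rewrite fcoefB => <-.
    by rewrite mul1r; field.
  have /fpsP/(_ n) := gam_off a b neq_ab.
  rewrite fcoefB fcoefD fcoefZ fcoef0 => /eqP; rewrite subr_eq0 => /eqP gl.
  rewrite mul0r mul0r subr0.
  transitivity ((r == 0)%N%:R * (s == 0)%N%:R / 2 * (gam a b n + gam b a n)).
    by rewrite gl; field.
  by field.
rewrite P2_coef gamE stuffle_gtilde //.
transitivity (E2 gam a b r.+1 s.+1 n + E2 gam b a s.+1 r.+1 n
  + (a == b)%:R * E1 R a (r.+1 + s.+1) n); last by [].
rewrite !E2_coef !beta2E !epsilonE -E1E.
ring.
Qed.

(** Each of the two sums of [epsilon] supplies one half of the diagonal term in [shuffle_gtilde].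
    What remains in weight two is absorbed by the equation of [suitable] involving [a + b]. *)
Lemma shuffle_E2 a b r s : P2 lam a b r.+1 s.+1
  = \sum_(i < (r + s).+1)
      ('C(i, r)%:R *: E2 gam (a + b) b i.+1 (r + s - i).+1
       + 'C(i, s)%:R *: E2 gam (a + b) a i.+1 (r + s - i).+1).
Proof.
case: suit => _ _ _ gam_add; apply/fpsP => n.
have sumE (k t : nat) (c : Zmod N) :
    \sum_(i < t.+1) 'C(i, k)%:R * E2 gam (a + b) c i.+1 (t - i).+1 n
    = \sum_(i < t.+1) 'C(i, k)%:R * gtilde2 R (a + b) c i.+1 (t - i).+1 n
      + \sum_(i < t.+1) 'C(i, k)%:R * beta2 R (a + b) c i.+1 (t - i).+1 n
      + (2 * N%:R)^-1 *
        \sum_(i < t.+1) 'C(i, k)%:R * epsilon gam (a + b) c i.+1 (t - i).+1 n.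
  under eq_bigr do rewrite E2_coef 2!mulrDr.
  rewrite !big_split mulr_sumr; congr (_ + _ + _).
  by apply: eq_bigr => i _; rewrite mulrCA.
have gamE : (r == 0)%N%:R * (s == 0)%N%:R * lam a b n
    = (2 * N%:R)^-1 * (N%:R * ((r == 0)%N%:R * (s == 0)%N%:R) * gam (a + b) b n
        + N%:R * ((s == 0)%N%:R * (r == 0)%N%:R) * gam (a + b) a n
        - (r == 0)%N%:R * (s == 0)%N%:R * dgtilde R b 0 n
        - (s == 0)%N%:R * (r == 0)%N%:R * dgtilde R a 0 n).
  have dg0 (c : Zmod N) : dgtilde R c 0 n = N%:R * f2 R c n by rewrite dgtilde0.
  have gl : gam (a + b) a n + gam (a + b) b n - 2 * lam a b n = f2 R a n + f2 R b n.
    by have /fpsP/(_ n) := gam_add a b.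
  rewrite !dg0; transitivity ((r == 0)%N%:R * (s == 0)%N%:R / 2 *
      (gam (a + b) a n + gam (a + b) b n - (f2 R a n + f2 R b n))).
    by rewrite -gl; field.
  by field.
rewrite P2_coef shuffle_gtilde // fcoef_sum gamE.
transitivity (\sum_(i < (r + s).+1) 'C(i, r)%:R * E2 gam (a + b) b i.+1 (r + s - i).+1 n
    + \sum_(i < (r + s).+1) 'C(i, s)%:R * E2 gam (a + b) a i.+1 (r + s - i).+1 n); last first.
  by rewrite -big_split.
have eps_s := sum_bin_epsilon (a + b) a s r n; rewrite [(s + r)%N]addnC in eps_s.
rewrite !sumE sum_bin_epsilon eps_s.
have binE : 'C(r + s, s) = 'C(r + s, r) by rewrite -bin_sub ?leq_addl // addnK.
rewrite binE -[_ + beta R a r.+1 * _ + _]addrA shuffle_beta.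
by field.
Qed.



End Regularization.

End Relations.

(** * Solvability of the linear system over residue classes *)

(** Möbius inversion by recursion: the new value of [psi] is that of [phi] less the contributions of
    the proper divisors. *)
Lemma divisor_sum_decomposition (F : zmodType) (phi : nat -> F) (K : nat) :
  exists psi : nat -> F, forall d, (0 < d <= K)%N ->
    phi d = \sum_(1 <= D < K.+1 | (D %| d)%N) psi D.
Proof.
elim: K => [|K [psi psiP]]; first by exists (fun=> 0) => d; lia.
pose rest := \sum_(1 <= D < K.+1 | (D %| K.+1)%N) psi D.
exists (fun D => if D == K.+1 then phi K.+1 - rest else psi D) => d /andP[d_gt0 le_dK].
have psiE (P : pred nat) : \sum_(1 <= D < K.+1 | P D)
    (if D == K.+1 then phi K.+1 - rest else psi D) = \sum_(1 <= D < K.+1 | P D) psi D.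
  rewrite big_nat_cond [RHS]big_nat_cond; apply: eq_bigr => D /andP[/andP[_ lt_DK] _].
  by rewrite ltn_eqF.
rewrite big_mkcond big_nat_recr // -big_mkcond /= psiE eqxx.
move: le_dK; rewrite leq_eqVlt => /predU1P[->|lt_dK].
  by rewrite dvdnn /rest addrC subrK.
by rewrite gtnNdvd // addr0 -psiP // d_gt0.
Qed.

Lemma sum_multiples (V : nmodType) (F : nat -> V) (M K : nat) : (0 < M)%N ->
  \sum_(0 <= v < M * K | (M %| v)%N) F v = \sum_(0 <= w < K) F (M * w)%N.
Proof.
move=> M_gt0; elim: K => [|K IHK]; first by rewrite muln0 !big_nil.
rewrite big_nat_recr // -IHK (@big_cat_nat _ _ _ (M * K)) ?leq_mul //=; congr (_ + _).
rewrite mulnS big_ltn_cond ?dvdn_mulr //; last by lia.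
rewrite big_nat_cond big1 ?addr0 // => v /andP[/andP[lt_v v_lt] dvd_v].
have /dvdn_leq : (M %| v - M * K)%N by rewrite dvdn_sub ?dvdn_mulr.
lia.
Qed.

Section Existence.
Variables (F : numFieldType) (n : nat).
Implicit Types (a b x y : 'I_n.+1) (p q : 'I_n.+1 * 'I_n.+1).
Implicit Type G : 'I_n.+1 -> 'I_n.+1 -> F.

(** The left-hand side of the system after the elimination of [lam]. *)
Definition boundary (V : zmodType) (gam : 'I_n.+1 -> 'I_n.+1 -> V) a b : V :=
  gam (a + b) a + gam (a + b) b - (gam a b + gam b a).

Definition sym_delta p a b : F := ((a, b) == p)%:R + ((b, a) == p)%:R.

(* [p] and [q] index the same relation modulo the image of [boundary]. *)
Definition homologous p q :=
  exists G, forall a b, boundary G a b = sym_delta p a b - sym_delta q a b.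

Lemma homologous_trans p q r : homologous p q -> homologous q r -> homologous p r.
Proof.
move=> [G1 bG1] [G2 bG2]; exists (fun a b => G1 a b + G2 a b) => a b.
transitivity (boundary G1 a b + boundary G2 a b); first by rewrite /boundary; ring.
by rewrite bG1 bG2; ring.
Qed.

Lemma homologous_swap x y : homologous (x, y) (y, x).
Proof.
exists (fun _ _ => 0) => a b; rewrite /boundary /sym_delta !xpair_eqE.
by rewrite [(b == x) && _]andbC [(b == y) && _]andbC; ring.
Qed.

(** A single delta function suffices: the terms with first argument [a + b] detect [(x, y)], the
    other two detect [(x + y, y)]. *)
Lemma homologous_sub x y : homologous (x + y, y) (x, y).
Proof.
exists (fun a b => - ((a, b) == (x + y, y))%:R) => a b; rewrite /boundary /sym_delta.
have addE c d : ((c + d, d) == (x + y, y)) = ((c, d) == (x, y)).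
  rewrite !xpair_eqE; have [->|] := eqVneq d y; last by rewrite !andbF.
  by rewrite !andbT (inj_eq (addIr y)).
by rewrite addE [a + b]addrC addE; ring.
Qed.

(** The subtractive Euclidean algorithm on representatives, by induction on [i + j]. *)
Lemma homologous_gcdn (i j : nat) :
  homologous (inZp i, inZp j) (inZp (gcdn i j), inZp 0).
Proof.
have [k] := ubnP (i + j); elim: k i j => // k IHk i j.
rewrite ltnS => le_ijk; have [->|j_gt0] := posnP j.
  by rewrite gcdn0; exists (fun _ _ => 0) => a b; rewrite /boundary; ring.
have [le_ji|lt_ij] := leqP j i.
  have -> : inZp i = inZp (i - j) + inZp j :> 'I_n.+1.
    by apply: val_inj; rewrite /= modnDm subnK.
  apply: homologous_trans (homologous_sub _ _) _.
  have -> : gcdn i j = gcdn (i - j) j by rewrite gcdnC -[in LHS](subnK le_ji) gcdnDr gcdnC.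
  by apply: IHk; lia.
apply: homologous_trans (homologous_swap _ _) _.
have [->|i_gt0] := posnP i.
  by rewrite gcd0n; exists (fun _ _ => 0) => a b; rewrite /boundary; ring.
have -> : inZp j = inZp (j - i) + inZp i :> 'I_n.+1.
  by apply: val_inj; rewrite /= modnDm subnK // ltnW.
apply: homologous_trans (homologous_sub _ _) _.
have -> : gcdn i j = gcdn (j - i) i.
  by rewrite -[in LHS](subnK (ltnW lt_ij)) gcdnDr gcdnC.
by apply: IHk; lia.
Qed.

(** The class of [0] is that of [n.+1], so the algorithm can be run again on [gcdn x y] and the
    modulus. *)
Lemma homologous_gcdn3 x y :
  homologous (x, y) (inZp (gcdn (gcdn x y) n.+1), inZp 0).
Proof.
have := homologous_gcdn x y; rewrite !valZpK => hxy.
apply: (homologous_trans hxy).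
have -> : inZp 0 = inZp n.+1 :> 'I_n.+1 by apply: val_inj; rewrite /= modnn mod0n.
have := homologous_gcdn (gcdn x y) n.+1.
by have -> : inZp 0 = inZp n.+1 :> 'I_n.+1 by apply: val_inj; rewrite /= modnn mod0n.
Qed.

Variable V : lmodType F.
Implicit Type h : 'I_n.+1 -> 'I_n.+1 -> V.

(** A symmetric [h] is half the sum of the [sym_delta] weighted by its values. Each [sym_delta] is a
    boundary up to the representative of its gcd class, and the weights of each class add up to
    zero. *)
Lemma boundary_surj h : (forall a b, h a b = h b a) ->
  (forall D, (0 < D)%N -> (D %| n.+1)%N ->
     \sum_(x : 'I_n.+1 | (D %| x)%N) \sum_(y : 'I_n.+1 | (D %| y)%N) h x y = 0) ->
  exists gam, forall a b, boundary gam a b = h a b.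
Proof.
move=> hC h_dvd.
(* By inversion, any function of the gcd is a combination of indicators of divisibility by [D], on
   which the hypothesis applies. *)
have h_class (phi : nat -> F) :
      \sum_(x : 'I_n.+1) \sum_(y : 'I_n.+1) phi (gcdn (gcdn x y) n.+1) *: h x y = 0.
  have [psi psiP] := divisor_sum_decomposition phi n.+1.
  have gcd_bounds x y : (0 < gcdn (gcdn x y) n.+1 <= n.+1)%N.
    by rewrite gcdn_gt0 orbT dvdn_leq ?dvdn_gcdr.
  under eq_bigr do under eq_bigr do rewrite psiP // big_mkcond scaler_suml.
  under eq_bigr do rewrite exchange_big.
  rewrite exchange_big big1_seq //= => D; rewrite mem_index_iota => /andP[D_gt0 _].
  transitivity (psi D *: \sum_(x : 'I_n.+1 | (D %| x)%N)
      \sum_(y : 'I_n.+1 | (D %| y)%N && (D %| n.+1)%N) h x y).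
    rewrite scaler_sumr [RHS]big_mkcond; apply: eq_bigr => x _; case: ifP => dvd_x.
      rewrite scaler_sumr [RHS]big_mkcond; apply: eq_bigr => y _.
      by rewrite !dvdn_gcd dvd_x; case: ifP; rewrite ?scale0r.
    by rewrite big1 // => y _; rewrite !dvdn_gcd dvd_x scale0r.
  have [dvd_D|_] := boolP (D %| n.+1)%N.
    by under eq_bigr do under eq_bigl do rewrite andbT; rewrite h_dvd // scaler0.
  by rewrite big1 ?scaler0 // => x _; rewrite big1 // => y; rewrite andbF.
have /choice[G GP] : forall p, exists G, forall a b, boundary G a b
    = sym_delta p a b - sym_delta (inZp (gcdn (gcdn p.1 p.2) n.+1), inZp 0) a b.
  by case=> x y; exact: homologous_gcdn3.
exists (fun a b => 2^-1 *: \sum_x \sum_y G (x, y) a b *: h x y) => a b.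
transitivity (2^-1 *: \sum_x \sum_y boundary (G (x, y)) a b *: h x y).
  rewrite /boundary -!scalerDr -scalerBr; congr (_ *: _).
  rewrite -!big_split -sumrB; apply: eq_bigr => x _ /=.
  rewrite -!big_split -sumrB; apply: eq_bigr => y _ /=.
  by rewrite scalerBl !scalerDl.
under eq_bigr do under eq_bigr do rewrite GP scalerBl.
under eq_bigr do rewrite sumrB.
rewrite sumrB (h_class (fun d => sym_delta (inZp d, inZp 0) a b)) subr0.
transitivity (2^-1 *: (h a b + h b a)); last first.
  by rewrite -hC -mulr2n -scaler_nat scalerA mulVf ?scale1r // pnatr_eq0.
congr (_ *: _).
have delta_sum c d : \sum_x \sum_y ((c, d) == (x, y))%:R *: h x y = h c d.
  rewrite (bigD1 c) //= (bigD1 d) //= eqxx scale1r big1 ?addr0 => [|y neq_yd].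
    rewrite big1 ?addr0 // => x neq_xc; rewrite big1 // => y _.
    by rewrite xpair_eqE eq_sym (negPf neq_xc) scale0r.
  by rewrite xpair_eqE [d == y]eq_sym (negPf neq_yd) andbF scale0r.
rewrite -(delta_sum a b) -(delta_sum b a) -big_split; apply: eq_bigr => x _ /=.
by rewrite -big_split; apply: eq_bigr => y _ /=; rewrite scalerDl.
Qed.

End Existence.

(** * The distribution relation and the existence of [gam] and [lam] *)

Section Suitable.
Variables (R : realType) (N : nat).
Hypothesis N_gt0 : (0 < N)%N.
Local Notation C := R[i].
Local Notation ee := (eta R N).

Lemma sum_Zmod_multiples (V : nmodType) (D M : nat) (E : nat -> V) :
    (0 < D)%N -> N = (D * M)%N ->
  \sum_(x : Zmod N | (D %| x)%N) E x = \sum_(l < M) E (D * l)%N.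
Proof.
move=> D_gt0 N_DM; rewrite -(big_mkord (fun x => D %| x)%N E) prednK // N_DM.
by rewrite sum_multiples // big_mkord.
Qed.

(** Orthogonality of characters on the subgroup of multiples of [D], which has [M] elements. *)
Lemma sum_eta_multiples (D M v : nat) : (0 < D)%N -> N = (D * M)%N ->
  \sum_(x : Zmod N | (D %| x)%N) ee ^+ (x * v) = M%:R * (M %| v)%N%:R.
Proof.
move=> D_gt0 N_DM; rewrite (sum_Zmod_multiples (fun x => ee ^+ (x * v)) D_gt0 N_DM).
have -> : (M %| v)%N = (ee ^+ (D * v) == 1) by rewrite eta_eq1 // {1}N_DM dvdn_pmul2l.
under eq_bigr do rewrite mulnAC exprM.
by rewrite sum_unity_root // -exprM mulnAC -N_DM exprM expr_eta // expr1n.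
Qed.

Lemma qsum2_multiples (c : nat -> nat -> C) (M k : nat) : (0 < M)%N ->
  qsum2 (fun u v => (M %| v)%N%:R * c u v) k
  = \sum_(1 <= u < k.+1) \sum_(1 <= w < k.+1 | (u * (M * w) == k)%N) c u (M * w)%N.
Proof.
move=> M_gt0; case: k => [|k]; first by rewrite /= !big_geq.
apply: eq_big_nat => u /andP[u_gt0 _].
pose E v := if (u * v == k.+1)%N then c u v else 0.
have E0 v : (k.+1 < v)%N -> E v = 0 by rewrite /E; case: eqP => //; nia.
(* The range is extended so that [v = M w] matches all [w < k + 2]. The added terms vanish, also the
   one at [v = 0], because the exponent is positive. *)
transitivity (\sum_(0 <= v < M * k.+2 | (M %| v)%N) E v).
  rewrite [RHS](@big_cat_nat _ _ _ k.+2) ?leq_pmull //= [X in _ + X]big_nat_cond.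
  rewrite [X in _ + X]big1 ?addr0 => [|v /andP[/andP[lt_kv _] _]]; last exact: E0.
  rewrite [RHS]big_ltn_cond // dvdn0 /E muln0 add0r.
  rewrite big_mkcond [RHS]big_mkcond; apply: eq_bigr => v _.
  by case: (u * v == _)%N; case: (M %| v)%N; rewrite ?mul1r ?mul0r.
rewrite sum_multiples // big_ltn // muln0 /E muln0 add0r.
by rewrite [RHS]big_mkcond.
Qed.

(** Both sides run over [u M w = k], with summands [M u] and [M w]; exchanging [u] and [w] matches
    them. *)
Lemma qsum2_multiples_sym (M k : nat) : (0 < M)%N ->
  M%:R * qsum2 (fun u v => (M %| v)%N%:R * u%:R : C) k
  = qsum2 (fun u v => (M %| v)%N%:R * v%:R) k.
Proof.
move=> M_gt0; rewrite !qsum2_multiples // (exchange_big_dep xpredT) //= mulr_sumr.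
apply: eq_bigr => u _; rewrite mulr_sumr.
under [RHS]eq_bigr do rewrite natrM.
by apply: eq_bigl => w; congr (_ == _); ring.
Qed.

Lemma sum_f2_gtilde (D M : nat) : (0 < D)%N -> N = (D * M)%N ->
  M%:R *: \sum_(x : Zmod N | (D %| x)%N) f2 R x
  = \sum_(x : Zmod N | (D %| x)%N) gtilde R x 2.
Proof.
move=> D_gt0 N_DM.
have M_gt0 : (0 < M)%N by move: N_gt0; rewrite N_DM muln_gt0 => /andP[].
apply/fpsP => k; rewrite fcoefZ !fcoef_sum.
have sum_qsum2 (w : nat -> nat -> C) : \sum_(x : Zmod N | (D %| x)%N)
      qsum2 (fun u v => ee ^+ (x * v) * w u v) k
    = M%:R * qsum2 (fun u v => (M %| v)%N%:R * w u v) k.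
  rewrite -qsum2Z exchange_big /=; apply: eq_bigr => u _.
  rewrite exchange_big /=; apply: eq_bigr => v _.
  by rewrite -mulr_suml (sum_eta_multiples _ D_gt0 N_DM) mulrA.
have -> : \sum_(x : Zmod N | (D %| x)%N) f2 R x k
    = (N%:R ^+ 2)^-1 * (M%:R * qsum2 (fun u v => (M %| v)%N%:R * u%:R) k).
  by rewrite -sum_qsum2 mulr_sumr.
have -> : \sum_(x : Zmod N | (D %| x)%N) gtilde R x 2 k
    = (N%:R ^+ 2)^-1 * (M%:R * qsum2 (fun u v => (M %| v)%N%:R * v%:R) k).
  rewrite -sum_qsum2 mulr_sumr; apply: eq_bigr => x _.
  by rewrite fcoefZ sqrrN expr1n [_ * 1%:R]mulr1 mul1r.
by rewrite qsum2_multiples_sym // mulrCA.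
Qed.

Lemma exists_suitable : exists gam lam : Zmod N -> Zmod N -> fps C, suitable gam lam.
Proof.
(* The first two equations determine [2 lam a b] as [gam a b + gam b a], less [2 gtilde a 2] if
   [a = b]; inserted in the third, this leaves [boundary gam = h]. *)
pose h (a b : Zmod N) : fps C := f2 R a + f2 R b - (a == b)%:R *: (2 *: gtilde R a 2).
have hC a b : h a b = h b a.
  by rewrite /h [f2 R a + _]addrC [b == a]eq_sym; case: eqVneq => [->|]; rewrite ?scale0r.
have h_dvd D : (0 < D)%N -> (D %| N.-1.+1)%N ->
    \sum_(x : Zmod N | (D %| x)%N) \sum_(y : Zmod N | (D %| y)%N) h x y = 0.
  move=> D_gt0 /dvdnP[M]; rewrite [LHS]prednK // mulnC => N_DM.
  have card_D (V : lmodType C) (e : V) : \sum_(x : Zmod N | (D %| x)%N) e = M%:R *: e.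
    by rewrite (sum_Zmod_multiples (fun=> e) D_gt0 N_DM) sumr_const card_ord scaler_nat.
  have scale_sum k (E : Zmod N -> fps C) : k *: (\sum_(x : Zmod N | (D %| x)%N) E x)
      = \sum_(x : Zmod N | (D %| x)%N) k *: E x by rewrite scaler_sumr.
  have sum_delta (x : Zmod N) : (D %| x)%N -> \sum_(y : Zmod N | (D %| y)%N)
      (x == y)%:R *: (2 *: gtilde R x 2) = 2 *: gtilde R x 2.
    move=> dvd_x; rewrite (bigD1 x) //= eqxx scale1r big1 ?addr0 // => y.
    by case/andP=> _ neq_yx; rewrite eq_sym (negPf neq_yx) scale0r.
  (* The total is [2 M] times the sum of [f2] minus twice that of [gtilde _ 2], which is zero by
     [sum_f2_gtilde]. *)
  transitivity (\sum_(x : Zmod N | (D %| x)%N) (M%:R *: f2 R x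
      + \sum_(y : Zmod N | (D %| y)%N) f2 R y - 2 *: gtilde R x 2)).
    apply: eq_bigr => x dvd_x; rewrite /h sumrB big_split /= sum_delta //.
    by rewrite card_D.
  rewrite sumrB big_split /= card_D -(scale_sum _ (fun x => f2 R x)).
  rewrite -(scale_sum _ (fun x => gtilde R x 2)) -(sum_f2_gtilde D_gt0 N_DM).
  by rewrite [2 *: _]scaler_nat -mulr2n subrr.
have [gam gamP] := boundary_surj hC h_dvd.
pose lam a b := 2^-1 *: (gam a b + gam b a) - (a == b)%:R *: gtilde R a 2.
have scale2 (f : fps C) : 2 *: (2^-1 *: f) = f.
  by rewrite scalerA divff ?scale1r // pnatr_eq0.
exists gam, lam; split=> [a b|a|a b neq_ab|a b].
- rewrite /lam [gam a b + _]addrC [b == a]eq_sym.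
  by case: eqVneq => [->|]; rewrite ?scale0r.
- rewrite /lam eqxx scale1r scalerDr -scalerDl -div1r -splitr scale1r.
  by rewrite opprB addrC subrK.
- by rewrite /lam (negPf neq_ab) scale0r subr0 scale2 subrr.
transitivity (boundary gam a b + (a == b)%:R *: (2 *: gtilde R a 2)).
  by rewrite /boundary /lam scalerBr scale2 opprB addrA addrAC !scalerA [2 * _]mulrC.
by rewrite gamP subrK.
Qed.

End Suitable.

Theorem theorem6p3 (R : realType) (N : nat) (N_gt0 : (0 < N)%N) :
  (exists gam lam : Zmod N -> Zmod N -> fps R[i], suitable gam lam) /\
  (forall gam lam : Zmod N -> Zmod N -> fps R[i], suitable gam lam ->
   forall (r s : nat) (a b : Zmod N), (0 < r)%N -> (0 < s)%N ->
     P2 lam a b r s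
       = E2 gam a b r s + E2 gam b a s r + (a == b)%:R *: E1 R a (r + s)
     /\
     P2 lam a b r s
       = \sum_(1 <= i < r + s)
           ('C(i.-1, r.-1)%:R *: E2 gam (a + b) b i (r + s - i)
            + 'C(i.-1, s.-1)%:R *: E2 gam (a + b) a i (r + s - i))).
Proof.
split=> [|gam lam suit [|r] [|s] a b // _ _]; first exact: exists_suitable.
split; first exact: (stuffle_E2 N_gt0 suit).
rewrite (shuffle_E2 N_gt0 suit) addSn addnS big_add1 big_mkord.
by apply: eq_bigr => i _; rewrite subSS subSn // -ltnS ltn_ord.
Qed.
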